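(* Let $(S_1,\dots,S_N)$ be contracting similarities of $\mathbb{R}^d$ with ratios $r_i\in(0,1)$, let $(p_1,\dots,p_N)$ be a probability vector with all $p_i>0$ ($N\ge 2$), and let $K$ and $\mu$ be the associated self-similar set and self-similar measure. Assume that the Open Set Condition is satisfied. Let $\alpha_{\min}=\min_i \frac{\log p_i}{\log r_i}$ and $\alpha_{\max}=\max_i\frac{\log p_i}{\log r_i}$. If $I\subseteq\mathbb{R}$ is a closed subinterval of $[\alpha_{\min},\alpha_{\max}]$, then $$\dim_H\{x\in K: A(D(x))\subseteq I\}=\sup_{\alpha\in I}\beta^*(\alpha).$$
   Context: $K$ is the unique non-empty compact subset of $\mathbb{R}^d$ with $K=\bigcup_{i=1}^N S_i(K)$, and $\mu$ is the unique Borel probability measure on $\mathbb{R}^d$ with $\mu=\sum_{i=1}^N p_i\,\mu\circ S_i^{-1}$; the support of $\mu$ is $K$. Open Set Condition (OSC): there exists an open, non-empty and bounded set $U\subseteq\mathbb{R}^d$ such that $\bigcup_i S_i(U)\subseteq U$ and $S_i(U)\cap S_j(U)=\emptyset$ for all $i\ne j$. For $x\in K$ and $r>0$ (with $r \neq 1$), $D_r(x)=\frac{\log\mu(B(x,r))}{\log r}$, where $B(x,r)$ is the closed ball of radius $r$ centered at $x$. The set of accumulation points of $D_r(x)$ as $r\searrow 0$ is $$A(D(x))=\{y\in(0,+\infty): \lim_{k\to\infty}D_{r_k}(x)=y \text{ for some sequence } r_k\searrow 0\}.$$ The function $\beta:\mathbb{R}\to\mathbb{R}$ is defined by $\sum_{i=1}^N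 p_i^q r_i^{\beta(q)}=1$ for $q\in\mathbb{R}$. The Legendre transform of $\varphi:\mathbb{R}\to\mathbb{R}$ is $\varphi^*(x)=\inf_{y\in\mathbb{R}}(xy+\varphi(y))$; thus $\beta^*(\alpha)=\inf_{q\in\mathbb{R}}(\alpha q+\beta(q))$. ''Closed subinterval'' means a non-empty closed interval; a singleton is regarded as a closed subinterval. $\dim_H$ denotes Hausdorff dimension. *)

(* Defs.v *)
From HB Require Import structures.
From mathcomp Require Import all_boot all_order all_algebra.
From mathcomp Require Import all_classical all_reals all_analysis.

Set Implicit Arguments.
Unset Strict Implicit.
Unset Printing Implicit Defensive.

Import Order.TTheory GRing.Theory Num.Theory.
Import numFieldNormedType.Exports.

Local Open Scope classical_set_scope.
Local Open Scope ring_scope.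

(* The library norm `|x| on 'rV[R]_d is the sup norm.  It induces the usual
   topology, so the library's open, compact and bounded sets are the usual ones,
   but similarities, balls and diameters need the Euclidean norm. *)
Definition enorm (R : realType) (d : nat) (x : 'rV[R]_d) : R :=
  Num.sqrt (\sum_(i < d) x ord0 i ^+ 2).

Definition closed_eball (R : realType) (d : nat) (x : 'rV[R]_d) (r : R) :
  set 'rV[R]_d := [set y | enorm (y - x) <= r].

Definition borel_rV (R : realType) (d : nat) :=
  g_sigma_algebraType (@open 'rV[R]_d).

Definition similarity (R : realType) (d : nat) (r : R)
  (S : 'rV[R]_d -> 'rV[R]_d) : Prop :=
  forall x y, enorm (S x - S y) = r * enorm (x - y).

Definition self_similar_set (R : realType) (d N : nat)
  (S : 'I_N -> 'rV[R]_d -> 'rV[R]_d) (K : set 'rV[R]_d) : Prop :=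
  [/\ K !=set0, compact K & K = \bigcup_i (S i @` K)].

Definition self_similar_measure (R : realType) (d N : nat)
  (S : 'I_N -> 'rV[R]_d -> 'rV[R]_d) (p : 'I_N -> R)
  (mu : probability (borel_rV R d) R) : Prop :=
  forall A : set (borel_rV R d), measurable A ->
    mu A = (\sum_(i < N) (p i)%:E * mu (S i @^-1` A))%E.

Definition open_set_condition (R : realType) (d N : nat)
  (S : 'I_N -> 'rV[R]_d -> 'rV[R]_d) : Prop :=
  exists U : set 'rV[R]_d,
    [/\ open U, U !=set0, bounded_set U,
        \bigcup_i (S i @` U) `<=` U &
        forall i j : 'I_N, i != j -> (S i @` U) `&` (S j @` U) = set0].

Definition ball_exponent (R : realType) (d : nat)
  (mu : probability (borel_rV R d) R) (x : 'rV[R]_d) (r : R) : R :=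
  ln (fine (mu (closed_eball x r))) / ln r.

(* Accumulation points in (0, +oo) of a real function D at 0+. *)
Definition acc_points (R : realType) (D : R -> R) : set R :=
  [set y : R | 0 < y /\ exists r_ : nat -> R,
    [/\ forall k, 0 < r_ k, decreasing_seq r_, r_ k @[k --> \oo] --> (0 : R) &
        D (r_ k) @[k --> \oo] --> y]].

Definition legendre (R : realType) (phi : R -> R) (x : R) : \bar R :=
  ereal_inf [set (x * y + phi y)%:E | y in [set: R]].

(* Equal to -oo for the empty set. *)
Definition diam (R : realType) (d : nat) (A : set 'rV[R]_d) : \bar R :=
  ereal_sup [set (enorm (xy.1 - xy.2))%:E | xy in A `*` A].

(* diam(A)^s; the empty set weighs 0 and a point weighs 1 when s = 0. *)
Definition diam_pow (R : realType) (d : nat) (s : R) (A : set 'rV[R]_d) :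
  \bar R := if A == set0 then 0%E else poweR (diam A) s.

Definition hausdorff_content (R : realType) (d : nat) (s delta : R)
  (E : set 'rV[R]_d) : \bar R :=
  ereal_inf [set (\sum_(0 <= n <oo) diam_pow s (U n))%E | U in
    [set U : nat -> set 'rV[R]_d |
      E `<=` \bigcup_n U n /\ forall n, (diam (U n) <= delta%:E)%E]].

Definition hausdorff_measure (R : realType) (d : nat) (s : R)
  (E : set 'rV[R]_d) : \bar R :=
  ereal_sup [set hausdorff_content s delta E | delta in [set delta | 0 < delta]].

Definition hausdorff_dim (R : realType) (d : nat) (E : set 'rV[R]_d) :
  \bar R :=
  ereal_inf [set s%:E | s in [set s | 0 <= s /\ hausdorff_measure s E = 0%E]].

(* The idx +oo (resp. -oo) is neutral, so for N > 0 these are the minimum and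
   the maximum of log p_i / log r_i. *)
Definition alpha_min (R : realType) (N : nat) (p r : 'I_N -> R) : \bar R :=
  \big[Order.min/+oo%E]_(i < N) (ln (p i) / ln (r i))%:E.

Definition alpha_max (R : realType) (N : nat) (p r : 'I_N -> R) : \bar R :=
  \big[Order.max/-oo%E]_(i < N) (ln (p i) / ln (r i))%:E.

(* Main.v *)
Require Import Defs.
From HB Require Import structures.
From mathcomp Require Import all_boot all_order all_algebra.
From mathcomp Require Import all_classical all_reals all_analysis.
From mathcomp Require Import ring lra.
Import Order.TTheory GRing.Theory Num.Theory.
Import numFieldNormedType.Exports.
Local Open Scope classical_set_scope.
Local Open Scope ring_scope.
Set Implicit Arguments.
Unset Strict Implicit.
Unset Printing Implicit Defensive.

(** The exponent of a ball is governed by the words coding the cylinders near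
    it.  Write [p_w], [r_w] for the products of the weights and of the ratios
    along a word [w], and cut the tree of words at scale [rho]: [cut rho] is
    the set of words whose ratio first drops to [rho].  The open set condition
    packs the cylinders of a cut, so that a ball of radius [rho] meets only
    boundedly many of them ([count_cylinders]).  Hence its mass is at most a
    constant times the largest weight of a nearby cylinder, and at least a
    constant times the weight of a cylinder through its centre
    ([mass_ball_upper], [mass_ball_lower]).  Both estimates rest on the
    attractor having full mass ([mass_attractor]).

    Upper bound.  Let I = [a, b].  For every [q], the numbers
    [p_v ^ q * r_v ^ beta q] over a cut sum up to 1.  If all accumulation
    points of the exponents at a point lie in I, then eventually the exponents
    lie below [b + e] and above [a - e]; this produces at each small scale
    [rho] a nearby cylinder with [p_v ^ q] at least about [rho ^ (b * q)] when
    [q >= 0], and [rho ^ (a * q)] when [q < 0].  Counting such cylinders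
    ([cylinder_cover]) bounds the dimension by
    [max (a * q) (b * q) + beta q] ([hausdorff_measure_level_set]).  As [beta]
    is convex, the infimum of these bounds over [q] is matched by the
    Legendre transform at some [al] in I ([legendre_minimax]).

    Lower bound.  Fix [al] in I.  Near [al] there is [al'] for which
    [al' * q + beta q] has a minimizer [q] ([legendre_minimizer]); under the
    probability vector [p_i ^ q * r_i ^ beta q] the variable
    [ln p_i - al' * ln r_i] then has mean 0 ([gibbs_mean]).  By exponential
    moments most long words satisfy [p_w = r_w ^ al'] up to a small power, and
    each of them has probability about [r_w ^ (al' * q + beta q)], which is at
    most [r_w ^ s] for any [s] below the Legendre transform at [al]
    ([block_exists]).  Concatenating blocks of such words, of slowly increasing
    length and accuracy, spells the points of a Moran set.

    Two things could go wrong: foreign cylinders of larger weight near a point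
    of this set, and distant words with nearby points.  Both are prevented by
    ending each block with a buffer, a word [u] such that the cylinder of
    [x ++ u] is well separated from everything outside the cylinder of [x].
    Schief's maximality argument yields a buffer ([buffer_exists]).  So the
    exponents of balls converge to [al] on the whole Moran set
    ([coded_exponent]), and a small set meets it along a single path down to
    the generation of its size ([small_set_path]).  A cover of too small total
    cost would then leave some path uncovered ([path_avoiding]), which bounds
    the Hausdorff dimension from below ([hausdorff_measure_neq0]). *)

(** * Euclidean geometry of similarities *)

Section Euclidean.
Context (R : realType) (d : nat).
Implicit Types x y z : 'rV[R]_d.

Definition dot x y : R := \sum_(i < d) x ord0 i * y ord0 i.

Lemma dotC x y : dot x y = dot y x.
Proof. by apply: eq_bigr => i _; rewrite mulrC. Qed.

Lemma dotDl x y z : dot (x + y) z = dot x z + dot y z.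
Proof. by rewrite -big_split; apply: eq_bigr => i _; rewrite mxE mulrDl. Qed.

Lemma dotZl a x y : dot (a *: x) y = a * dot x y.
Proof. by rewrite mulr_sumr; apply: eq_bigr => i _; rewrite mxE mulrA. Qed.

Lemma dotNl x y : dot (- x) y = - dot x y.
Proof. by rewrite -scaleN1r dotZl mulN1r. Qed.

Lemma dotBl x y z : dot (x - y) z = dot x z - dot y z.
Proof. by rewrite dotDl dotNl. Qed.

Lemma dotBr x y z : dot z (x - y) = dot z x - dot z y.
Proof. by rewrite dotC dotBl !(dotC z). Qed.

Lemma dot_ge0 x : 0 <= dot x x.
Proof. by apply: sumr_ge0 => i _; rewrite -expr2 sqr_ge0. Qed.

Lemma enormE x : enorm x = Num.sqrt (dot x x).
Proof. by congr Num.sqrt; apply: eq_bigr => i _; rewrite expr2. Qed.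

Lemma enorm_ge0 x : 0 <= enorm x.
Proof. exact: sqrtr_ge0. Qed.

Lemma enorm_sq x : enorm x ^+ 2 = dot x x.
Proof. by rewrite enormE sqr_sqrtr // dot_ge0. Qed.

Lemma enorm_sqB x y : enorm (x - y) ^+ 2 = dot x x - dot x y *+ 2 + dot y y.
Proof. by rewrite enorm_sq dotBl !dotBr (dotC y x); ring. Qed.

Lemma enorm0 : enorm (0 : 'rV[R]_d) = 0.
Proof. by rewrite /enorm big1 ?sqrtr0 // => i _; rewrite mxE expr0n. Qed.

Lemma enormN x : enorm (- x) = enorm x.
Proof. by congr Num.sqrt; apply: eq_bigr => i _; rewrite mxE sqrrN. Qed.

Lemma enormC x y : enorm (x - y) = enorm (y - x).
Proof. by rewrite -enormN opprB. Qed.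

Lemma enormZ a x : enorm (a *: x) = `|a| * enorm x.
Proof.
rewrite /enorm -sqrtr_sqr -sqrtrM ?sqr_ge0 // mulr_sumr.
by congr Num.sqrt; apply: eq_bigr => i _; rewrite mxE exprMn.
Qed.

Lemma coord_le_enorm x i : `|x ord0 i| <= enorm x.
Proof.
rewrite -sqrtr_sqr ler_wsqrtr // (bigD1 i) //= lerDl.
by apply: sumr_ge0 => j _; rewrite sqr_ge0.
Qed.

Lemma enorm_eq0 x : enorm x = 0 -> x = 0.
Proof.
move=> x0; apply/rowP => i; rewrite mxE; apply/eqP.
by rewrite -normr_le0 -x0 coord_le_enorm.
Qed.

Lemma enorm_le_sum x : enorm x <= \sum_(i < d) `|x ord0 i|.
Proof.
have s0 : 0 <= \sum_(i < d) `|x ord0 i| by apply: sumr_ge0.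
rewrite -(@ler_pXn2r _ 2) ?nnegrE ?enorm_ge0 //.
rewrite enorm_sq expr2 mulr_suml; apply: ler_sum => i _.
rewrite (le_trans (ler_norm _)) // normrM ler_wpM2l //.
by rewrite (bigD1 i) //= lerDl; apply: sumr_ge0.
Qed.

Lemma enormD x y : enorm (x + y) <= enorm x + enorm y.
Proof.
have CS : dot x y <= enorm x * enorm y.
  have [y0|yN0] := eqVneq (enorm y) 0.
    rewrite y0 mulr0 (enorm_eq0 y0) dotC.
    by rewrite -(scale0r x) dotZl mul0r.
  have y_gt0 : 0 < enorm y by rewrite lt_def yN0 enorm_ge0.
  have [x0|xN0] := eqVneq (enorm x) 0.
    by rewrite x0 mul0r (enorm_eq0 x0) -(scale0r y) dotZl mul0r.
  have x_gt0 : 0 < enorm x by rewrite lt_def xN0 enorm_ge0.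
  have := sqr_ge0 (enorm (enorm y *: x - enorm x *: y)).
  rewrite enorm_sqB !dotZl !(dotC _ (_ *: _)) !dotZl -!enorm_sq.
  move=> h; have {}h : dot x y * (enorm x * enorm y) <=
      (enorm x * enorm y) * (enorm x * enorm y) by rewrite (dotC x); nra.
  by rewrite ler_pM2r ?mulr_gt0 in h.
rewrite -(@ler_pXn2r _ 2) ?nnegrE ?addr_ge0 ?enorm_ge0 //.
rewrite -[y]opprK enorm_sqB -!enorm_sq enormN opprK dotC dotNl dotC.
by rewrite sqrrD mulNrn opprK lerD2r lerD2l lerMn2r CS orbT.
Qed.

Lemma enorm_triangle x y z : enorm (x - z) <= enorm (x - y) + enorm (y - z).
Proof. by have := enormD (x - y) (y - z); rewrite addrA subrK. Qed.

Lemma norm_le_enorm x : `|x| <= enorm x.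
Proof.
rewrite /Num.norm /= mx_normrE; apply: bigmax_le => [|[i j] _ /=].
  exact: enorm_ge0.
by rewrite [i]ord1 coord_le_enorm.
Qed.

Lemma enorm_le_norm x : enorm x <= d%:R * `|x|.
Proof.
apply: le_trans (enorm_le_sum x) _.
rewrite mulr_natl -[X in _ *+ X]card_ord -sumr_const.
apply: ler_sum => i _; rewrite /Num.norm /= mx_normrE.
exact: (le_bigmax _ (fun ij : 'I_1 * 'I_d => `|x ij.1 ij.2|) (ord0, i)).
Qed.

End Euclidean.
Section EuclideanTopology.
Context (R : realType) (d : nat).
Implicit Types (x y z : 'rV[R]_d) (K U : set 'rV[R]_d).

Lemma open_eball U x : open U -> U x ->
  exists2 c : R, 0 < c & forall y, enorm (y - x) <= c -> U y.
Proof.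
move=> oU Ux; have /nbhs_ballP[e /= e0 eU] := open_nbhs_nbhs (conj oU Ux).
exists (e / 2); first by rewrite divr_gt0.
move=> y yx; apply: eU; rewrite -ball_normE /= distrC.
by rewrite (le_lt_trans (norm_le_enorm _)) // (le_lt_trans yx) //; lra.
Qed.

Lemma nbhs_eball x (c : R) : 0 < c -> nbhs x [set y | enorm (y - x) < c].
Proof.
move=> c0; apply/nbhs_ballP; exists (c / d.+1%:R) => /=.
  by rewrite divr_gt0.
move=> y; rewrite -ball_normE /= distrC => yx.
rewrite (le_lt_trans (enorm_le_norm _)) //.
have d0 : (0 : R) <= d%:R by [].
move: yx; rewrite ltr_pdivlMr // => yx; rewrite -natr1 in yx.
by have := normr_ge0 (y - x); nra.
Qed.

Lemma enorm_continuous x : continuous (fun y : 'rV[R]_d => enorm (y - x)).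
Proof.
move=> y; apply/(@cvgrPdist_lt _ _ _ (nbhs y) (nbhs_filter y)) => e e0.
apply: filterS (nbhs_eball y e0) => z /= zy.
rewrite ltr_norml; apply/andP; split.
  by have := enorm_triangle z y x; lra.
by have := enorm_triangle y z x; rewrite (enormC y z); lra.
Qed.

Lemma closed_closed_eball x (r : R) : closed (closed_eball x r).
Proof.
have -> : closed_eball x r = (fun y => enorm (y - x)) @^-1` [set t | t <= r].
  by [].
apply: closed_comp; last exact: closed_le.
by move=> y _; exact: enorm_continuous.
Qed.

(** The open neighbourhoods of a set exhaust its closure; they serve in place
    of the distance function. *)
Definition nbhd K (e : R) : set 'rV[R]_d :=
  [set x | exists2 y, K y & enorm (x - y) < e].

Lemma open_nbhd K (e : R) : open (nbhd K e).
Proof.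
rewrite openE => x [y Ky xy].
have c0 : 0 < e - enorm (x - y) by rewrite subr_gt0.
apply: filterS (nbhs_eball x c0) => z /= zx; exists y => //.
by have := enorm_triangle z x y; lra.
Qed.

Lemma closed_nbhd K x : closed K -> (forall e : R, 0 < e -> nbhd K e x) -> K x.
Proof.
move=> cK h; apply: cK => B /nbhs_ballP[e /= e0 eB].
have [y Ky xy] := h _ e0; exists y; split => //; apply: eB.
by rewrite -ball_normE /= (le_lt_trans (norm_le_enorm _)).
Qed.

Lemma bounded_enorm K : bounded_set K ->
  exists2 C : R, 0 < C & forall x y, K x -> K y -> enorm (x - y) <= C.
Proof.
move=> [M [_ hM]]; have h x : K x -> `|x| <= `|M| + 1.
  by apply: hM; rewrite (le_lt_trans (ler_norm M)) // ltrDl.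
have M0 : 0 <= `|M| by [].
exists (d%:R * (2 * (`|M| + 1)) + 1) => [|x y Kx Ky].
  by rewrite ltr_wpDl // mulr_ge0 //; lra.
rewrite (le_trans (enorm_le_norm _)) // -[leLHS]addr0 lerD // ler_wpM2l //.
by rewrite (le_trans (ler_normB _ _)) //; have := h _ Kx; have := h _ Ky; lra.
Qed.

Lemma compact_enorm K : compact K ->
  exists2 C : R, 0 < C & forall x y, K x -> K y -> enorm (x - y) <= C.
Proof. by move=> cK; apply: bounded_enorm; exact: compact_bounded. Qed.

Lemma compact_closed_rV K : compact K -> closed K.
Proof. by apply: compact_closed; exact: norm_hausdorff. Qed.

End EuclideanTopology.

Section Similarity.
Context (R : realType) (d : nat) (r : R) (S : 'rV[R]_d -> 'rV[R]_d).
Hypotheses (r_gt0 : 0 < r) (simS : similarity r S).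

Lemma similarity_inj : injective S.
Proof.
move=> x y Sxy; apply/eqP; rewrite -subr_eq0; apply/eqP/enorm_eq0.
have := simS x y; rewrite Sxy subrr enorm0 => /esym/eqP.
by rewrite mulf_eq0 gt_eqF //= => /eqP.
Qed.

Lemma similarity_continuous : continuous S.
Proof.
move=> x; apply/(@cvgrPdist_lt _ _ _ (nbhs x) (nbhs_filter x)) => e e0.
have er0 : 0 < r^-1 * e by rewrite mulr_gt0 ?invr_gt0.
apply: filterS (nbhs_eball x er0) => y /= yx.
by rewrite (le_lt_trans (norm_le_enorm _)) // simS -ltr_pdivlMl // enormC.
Qed.

(** A similarity is onto: normalized to ratio 1 and to fix the origin it
    preserves inner products, so that it is the multiplication by the
    orthogonal matrix whose rows are the images of the basis vectors. *)
Lemma similarity_surj y : exists x, S x = y.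
Proof.
pose f x := r^-1 *: (S x - S 0).
have fN x z : enorm (f x - f z) = enorm (x - z).
  rewrite -scalerBr opprB addrA subrK enormZ simS gtr0_norm ?invr_gt0 //.
  by rewrite mulKf ?gt_eqF.
have f0 : f 0 = 0 by rewrite /f subrr scaler0.
have fdot1 x : dot (f x) (f x) = dot x x.
  by have := fN x 0; rewrite f0 !subr0 -!enorm_sq => ->.
have fdot x z : dot (f x) (f z) = dot x z.
  have : enorm (f x - f z) ^+ 2 = enorm (x - z) ^+ 2 by rewrite fN.
  by rewrite !enorm_sqB !fdot1; lra.
pose A : 'M[R]_d := \matrix_(i < d) f (delta_mx ord0 i).
have fA x : f x *m A^T = x.
  apply/rowP => i; rewrite mxE.
  transitivity (dot (f x) (f (delta_mx ord0 i))).
    by apply: eq_bigr => j _; rewrite !mxE.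
  rewrite fdot /dot (bigD1 i) //= big1 ?addr0 => [|j ji].
    by rewrite mxE !eqxx mulr1.
  by rewrite mxE (negPf ji) andbF mulr0.
have AA : A *m A^T = 1%:M.
  by apply/row_matrixP => i; rewrite row_mul rowK fA rowE mulmx1.
have fE x : f x = x *m A.
  by rewrite -[in RHS](fA x) -mulmxA (mulmx1C AA) mulmx1.
exists ((r^-1 *: (y - S 0)) *m A^T).
have : f ((r^-1 *: (y - S 0)) *m A^T) = r^-1 *: (y - S 0).
  by rewrite fE -mulmxA (mulmx1C AA) mulmx1.
move/scalerI => /(_ _)/addIr -> //.
by rewrite invr_neq0 // gt_eqF.
Qed.

End Similarity.
(** * Words and stopping sets *)

Lemma expr_small (R : realType) (c b : R) : 0 < c -> c < 1 -> 0 < b ->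
  exists n, c ^+ n < b.
Proof.
move=> c0 c1 b0.
have : (fun n => c ^+ n) @ \oo --> (0 : R).
  by apply: cvg_expr; rewrite gtr0_norm.
move/cvgrPdist_lt => /(_ _ b0)[n _ /(_ n (leqnn n))].
by rewrite sub0r normrN ger0_norm ?exprn_ge0 ?ltW //; exists n.
Qed.

Section Words.
Context (R : realType) (N : nat).
Implicit Types (f : 'I_N -> R) (v w x : seq 'I_N).

Definition wprod f w : R := \prod_(i <- w) f i.

Lemma wprod_nil f : wprod f [::] = 1.
Proof. exact: big_nil. Qed.

Lemma wprod_cons f i w : wprod f (i :: w) = f i * wprod f w.
Proof. exact: big_cons. Qed.

Lemma wprod_cat f v w : wprod f (v ++ w) = wprod f v * wprod f w.
Proof. exact: big_cat. Qed.

Lemma wprod_gt0 f w : (forall i, 0 < f i) -> 0 < wprod f w.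
Proof. by move=> f0; apply: prodr_gt0 => i _. Qed.

Lemma wprod_le1 f w : (forall i, 0 < f i < 1) -> wprod f w <= 1.
Proof.
move=> f01; apply: prodr_ile1 => i _.
by have /andP[/ltW -> /ltW ->] := f01 i.
Qed.

Lemma wprod_le_exp f (c : R) w : (forall i, 0 < f i <= c) ->
  wprod f w <= c ^+ size w.
Proof.
move=> fc; elim: w => [|i w IH]; first by rewrite wprod_nil expr0.
rewrite wprod_cons exprS; have /andP[fi0 fic] := fc i.
apply: ler_pM => //; first exact: ltW.
by apply: ltW; apply: wprod_gt0 => j; have /andP[] := fc j.
Qed.

Lemma wprod_ge_exp f (c : R) w : 0 < c -> (forall i, c <= f i) ->
  c ^+ size w <= wprod f w.
Proof.
move=> c0 fc; elim: w => [|i w IH]; first by rewrite wprod_nil expr0.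
by rewrite wprod_cons exprS ler_pM // ?exprn_ge0 // ltW.
Qed.

Lemma ln_wprod f w : (forall i, 0 < f i) ->
  ln (wprod f w) = \sum_(i <- w) ln (f i).
Proof.
move=> f0; elim: w => [|i w IH]; first by rewrite wprod_nil ln1 big_nil.
by rewrite wprod_cons lnM ?posrE ?wprod_gt0 // IH big_cons.
Qed.

Lemma fin_inf_gt0 f : (forall i, 0 < f i) ->
  exists c : R, [/\ 0 < c, c < 1 & forall i, c <= f i].
Proof.
move=> f0; exists (\big[Num.min/2^-1]_(i < N) f i); split.
- by apply/bigmin_gtP; split => [|i _] //; rewrite invr_gt0.
- by apply: le_lt_trans (bigmin_le_id _ _ _ _) _; lra.
- by move=> i; exact: bigmin_le.
Qed.

Lemma fin_sup_lt1 f : (forall i, 0 < f i < 1) ->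
  exists c : R, [/\ 0 < c, c < 1 & forall i, f i <= c].
Proof.
move=> f0; exists (\big[Num.max/2^-1]_(i < N) f i); split.
- by apply: lt_le_trans (bigmax_ge_id _ _ _ _); rewrite invr_gt0.
- by apply/bigmax_ltP; split => [|i _]; [lra|have /andP[] := f0 i].
- by move=> i; exact: le_bigmax.
Qed.

End Words.

Section StoppingSets.
Context (R : realType) (N : nat) (r : 'I_N -> R).
Hypothesis r01 : forall i, 0 < r i < 1.
Implicit Types (v w x : seq 'I_N) (b : R).

Let r_gt0 i : 0 < r i. Proof. by have /andP[] := r01 i. Qed.
Let r_lt1 i : r i < 1. Proof. by have /andP[] := r01 i. Qed.

(** [stop b w] holds when [w] is the shortest prefix of itself whose ratio is
    at most [b].  The recursion consumes the first letter and rescales [b],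
    which mirrors the self-similarity. *)
Fixpoint stop b w : bool :=
  if w is i :: w' then (b < 1) && stop (b / r i) w' else 1 <= b.

Lemma stop_ind (P : R -> Prop) :
  (forall b, 1 <= b -> P b) ->
  (forall b, 0 < b -> b < 1 -> (forall i, P (b / r i)) -> P b) ->
  forall b, 0 < b -> P b.
Proof.
move=> P1 Pr b b0; have [c [c0 c1 rc]] := fin_sup_lt1 r01.
have [n cn] : exists n, c ^+ n <= b.
  by have [n nb] := expr_small c0 c1 b0; exists n; apply: ltW.
elim: n b b0 cn => [|n IH] b b0; first by rewrite expr0; exact: P1.
move=> cn; have [/P1//|b1] := leP 1 b.
apply: Pr => // i; apply: IH; first by rewrite divr_gt0.
rewrite ler_pdivlMr //; apply: le_trans cn.
by rewrite exprSr ler_wpM2l // exprn_ge0 // ltW.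
Qed.

Lemma stop_ge1 b w : 1 <= b -> stop b w = (w == [::]).
Proof. by case: w => [|i w] /= b1; [rewrite b1|rewrite ltNge b1]. Qed.

Lemma stop_list b : 0 < b ->
  exists s : seq (seq 'I_N), uniq s /\ forall w, (w \in s) = stop b w.
Proof.
move: b; apply: stop_ind => [b b1|b b0 b1 IH].
  by exists [:: [::]]; split => // w; rewrite inE stop_ge1.
have [s hs] := choice IH.
exists (flatten [seq [seq i :: w | w <- s i] | i <- enum 'I_N]); split.
  apply/allpairs_uniq_dep => [|i _|]; first exact: enum_uniq.
  - by have [] := hs i.
  - by move=> [i v] [j w] _ _ /= [-> ->].
case=> [|i w] /=.
  rewrite leNgt b1; apply/negP => /flatten_mapP[i _ /mapP[w _]].
  by [].
rewrite b1 /= -(hs i).2; apply/flatten_mapP/idP => [[j _ /mapP[v vs [-> ->]]]//|ws].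
by exists i; rewrite ?mem_enum // map_f.
Qed.

(** The words of [stop b], once each. *)
Definition cut b : seq (seq 'I_N) :=
  xget [::] [set s | uniq s /\ forall w, (w \in s) = stop b w].

Lemma cutP b : 0 < b -> uniq (cut b) /\ forall w, (w \in cut b) = stop b w.
Proof. by move=> /stop_list/(xgetPex [::]). Qed.

Lemma cut_uniq b : 0 < b -> uniq (cut b).
Proof. by move=> /cutP[]. Qed.

Lemma mem_cut b w : 0 < b -> (w \in cut b) = stop b w.
Proof. by move=> /cutP[]. Qed.

Lemma cut_ge1 b (F : seq 'I_N -> R) : 1 <= b ->
  \sum_(w <- cut b) F w = F [::].
Proof.
move=> b1; have b0 : 0 < b by rewrite (lt_le_trans ltr01).
rewrite (perm_big [:: [::]]) ?big_seq1 //=; apply: uniq_perm => [||w] //.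
  exact: cut_uniq.
by rewrite mem_cut // stop_ge1 // inE.
Qed.

Lemma cut_rec b (F : seq 'I_N -> R) : 0 < b -> b < 1 ->
  \sum_(w <- cut b) F w = \sum_i \sum_(w <- cut (b / r i)) F (i :: w).
Proof.
move=> b0 b1; have br i : 0 < b / r i by rewrite divr_gt0.
rewrite (perm_big (flatten [seq [seq i :: w | w <- cut (b / r i)] | i <- enum 'I_N])).
  rewrite big_flatten big_map big_enum /=.
  by apply: eq_bigr => i _; rewrite big_map.
apply: uniq_perm; first exact: cut_uniq.
  apply/allpairs_uniq_dep => [|i _|]; first exact: enum_uniq.
  - exact: cut_uniq.
  - by move=> [i v] [j w] _ _ /= [-> ->].
move=> w; rewrite mem_cut //; case: w => [|i w] /=.
  by rewrite leNgt b1; apply/esym/negP => /flatten_mapP[i _ /mapP[w _]].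
rewrite b1 /=; apply/idP/flatten_mapP => [ws|[j _ /mapP[v]]].
  by exists i; rewrite ?mem_enum // map_f // mem_cut.
by rewrite mem_cut // => vs [-> ->].
Qed.

Lemma sum_cut_wprod b (f : 'I_N -> R) : 0 < b -> \sum_i f i = 1 ->
  \sum_(w <- cut b) wprod f w = 1.
Proof.
move=> + f1; move: b; apply: stop_ind => [b b1|b b0 b1 IH].
  by rewrite cut_ge1 // wprod_nil.
rewrite cut_rec // -[RHS]f1; apply: eq_bigr => i _.
under eq_bigr do rewrite wprod_cons.
by rewrite -mulr_sumr IH mulr1.
Qed.

Lemma stop_le b w : stop b w -> wprod r w <= b.
Proof.
elim: w b => [|i w IH] b /=; first by rewrite wprod_nil.
by case/andP=> _ /IH; rewrite wprod_cons ler_pdivlMr // mulrC.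
Qed.

Lemma stop_ge b w (c : R) : c < 1 -> (forall i, c <= r i) -> b <= 1 ->
  0 < b -> stop b w -> c * b <= wprod r w.
Proof.
move=> c1 cr + b0; elim: w b b0 => [|i w IH] b b0 b1 /=.
  by rewrite wprod_nil => _; nra.
case/andP=> {}b1 st; rewrite wprod_cons.
have [/ltW br|br] := ltP (b / r i) 1.
  have := IH _ (divr_gt0 b0 (r_gt0 i)) br st.
  by rewrite mulrA ler_pdivrMr // => h; rewrite [leRHS]mulrC.
move: st; rewrite stop_ge1 // => /eqP ->; rewrite wprod_nil mulr1.
by have := cr i; have := r_gt0 i; nra.
Qed.

Lemma stop_cat b x w : 0 < b -> b <= 1 -> stop b w ->
  stop (wprod r x * b) (x ++ w).
Proof.
move=> b0 b1 st; elim: x => [|i x IH]; first by rewrite wprod_nil mul1r.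
rewrite /= wprod_cons; apply/andP; split; last first.
  by rewrite (_ : _ / _ = wprod r x * b) //; field; rewrite gt_eqF.
have x1 : wprod r x <= 1 by exact: wprod_le1.
have x0 : 0 < wprod r x by exact: wprod_gt0.
have xb : wprod r x * b <= 1 by nra.
have xb0 : 0 < wprod r x * b by rewrite mulr_gt0.
by rewrite -mulrA; have := r_lt1 i; have := r_gt0 i; nra.
Qed.

Lemma stop_prefix b w : 0 < b -> wprod r w <= b ->
  exists2 v, prefix v w & stop b v.
Proof.
elim: w b => [|i w IH] b b0; first by rewrite wprod_nil; exists [::].
rewrite wprod_cons => h; have [b1|b1] := leP 1 b; first by exists [::].
have [|v vw sv] := IH (b / r i) (divr_gt0 b0 (r_gt0 i)).
  by rewrite ler_pdivlMr // mulrC.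
by exists (i :: v); rewrite /= ?eqxx // b1.
Qed.

Lemma wprod_small b : 0 < b -> exists n, forall w, (n <= size w)%N ->
  wprod r w < b.
Proof.
move=> b0; have [c [c0 c1 rc]] := fin_sup_lt1 r01.
have [n nb] := expr_small c0 c1 b0; exists n => w nw.
apply: le_lt_trans nb; apply: le_trans (wprod_le_exp (c := c) w _) _.
  by move=> i; rewrite r_gt0 rc.
by rewrite ler_wiXn2l // ltW.
Qed.

End StoppingSets.
(** * The iterated function system *)

Section Packing.
Context (R : realType) (d : nat).

(** Pigeonhole on a grid whose cells have side a little below [c * b / d]. *)
Lemma packing (C c : R) : 0 <= C -> 0 < c -> exists M : nat,
  forall (T : eqType) (s : seq T) (f : T -> 'rV[R]_d) z b, 0 < b -> uniq s ->
  {in s, forall v, enorm (f v - z) <= C * b} ->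
  {in s &, forall v w, v != w -> c * b <= enorm (f v - f w)} ->
  (size s <= M)%N.
Proof.
move=> C0 c0; pose h := c / d.+1%:R; have h0 : 0 < h by rewrite divr_gt0.
pose L := Num.truncn (2 * C / h).
exists #|{ffun 'I_d -> 'I_L.+1}| => T s f z b b0 us fz fs.
pose t v (i : 'I_d) := (f v ord0 i - z ord0 i + C * b) / (h * b).
have hb0 : 0 < h * b by rewrite mulr_gt0.
have t0 v i : v \in s -> 0 <= t v i.
  move=> /fz vz; rewrite divr_ge0 ?(ltW hb0) //.
  have := le_trans (coord_le_enorm (f v - z) i) vz.
  by rewrite !mxE ler_norml => /andP[]; lra.
have tL v i : v \in s -> (Num.truncn (t v i) < L.+1)%N.
  move=> vs; rewrite ltnS; apply: le_truncn.
  rewrite ler_pdivrMr // mulrA divfK ?gt_eqF //.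
  have := le_trans (coord_le_enorm (f v - z) i) (fz v vs).
  by rewrite !mxE ler_norml => /andP[]; lra.
pose g v : {ffun 'I_d -> 'I_L.+1} := [ffun i => inord (Num.truncn (t v i))].
have g_inj : {in s &, injective g}.
  move=> v w vs ws gvw; apply/eqP/negPn/negP => vw.
  have := fs v w vs ws vw; apply/negP; rewrite -ltNge.
  apply: le_lt_trans (enorm_le_sum _) _.
  have le1 i : `|(f v - f w) ord0 i| <= h * b.
    have := congr1 (fun F : {ffun _ -> _} => nat_of_ord (F i)) gvw.
    rewrite !ffunE !inordK ?tL // => tt.
    have /andP[v1 v2] := truncn_itv (t0 v i vs).
    have /andP[w1 w2] := truncn_itv (t0 w i ws).
    have -> : (f v - f w) ord0 i = (t v i - t w i) * (h * b).
      by rewrite !mxE /t -mulrBl divfK ?gt_eqF //; ring.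
    rewrite normrM (gtr0_norm hb0) ler_piMl ?(ltW hb0) // ler_norml.
    by move: v1 v2 w1 w2; rewrite tt -natr1; lra.
  apply: (@le_lt_trans _ _ (d%:R * (h * b))).
    by rewrite mulr_natl -[X in _ *+ X]card_ord -sumr_const; exact: ler_sum.
  rewrite /h mulrA ltr_pM2r // mulrCA gtr_pMr //.
  by rewrite ltr_pdivrMr // mul1r ltr_nat.
rewrite -(size_map g) -(card_uniqP _); first exact: max_card.
by rewrite map_inj_in_uniq.
Qed.

End Packing.

Section Cylinders.
Context (R : realType) (d N : nat).
Implicit Types (S : 'I_N -> 'rV[R]_d -> 'rV[R]_d) (v w x : seq 'I_N).

Definition wmap S w (y : 'rV[R]_d) : 'rV[R]_d := foldr S y w.

Definition cyl S (K : set 'rV[R]_d) w : set 'rV[R]_d := wmap S w @` K.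

(** The standing assumptions, bundled since nearly every statement about the
    system draws on most of them. *)
Record osc_system S (r p : 'I_N -> R) (K : set 'rV[R]_d)
    (mu : probability (borel_rV R d) R) : Prop := OscSystem {
  osc_card : (2 <= N)%N;
  ratio01 : forall i, 0 < r i < 1;
  simS : forall i, similarity (r i) (S i);
  weight_gt0 : forall i, 0 < p i;
  weight_sum : \sum_(i < N) p i = 1;
  attractor : self_similar_set S K;
  invariant_mu : self_similar_measure S p mu;
  open_set : open_set_condition S
}.

Lemma wmap_cat S v w y : wmap S (v ++ w) y = wmap S v (wmap S w y).
Proof. exact: foldr_cat. Qed.

Lemma wmap_similarity S r w :
  (forall i, similarity (r i) (S i)) -> similarity (wprod r w) (wmap S w).
Proof.
move=> sS; elim: w => [|i w IH] y z; first by rewrite wprod_nil mul1r.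
by rewrite /= sS IH wprod_cons mulrA.
Qed.

End Cylinders.

Section System.
Context (R : realType) (d N : nat).
Context (S : 'I_N -> 'rV[R]_d -> 'rV[R]_d) (r p : 'I_N -> R).
Context (K : set 'rV[R]_d) (mu : probability (borel_rV R d) R).
Hypothesis H : osc_system S r p K mu.
Implicit Types (v w x : seq 'I_N) (y z : 'rV[R]_d).

Let r01 := ratio01 H.
Lemma ratio_gt0 i : 0 < r i. Proof. by have /andP[] := r01 i. Qed.
Let r_gt0 := ratio_gt0.

Lemma weight01 i : 0 < p i < 1.
Proof.
have p0 := weight_gt0 H; rewrite p0 /= -(weight_sum H) (bigD1 i) //= ltrDl.
have [j ji] : exists j : 'I_N, j != i.
  have N2 := osc_card H; have N1 := ltnW N2.
  have [i0|i0] := eqVneq (i : nat) 0%N.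
    by exists (Ordinal N2); rewrite -val_eqE /= i0.
  by exists (Ordinal N1); rewrite -val_eqE /= eq_sym.
rewrite (bigD1 j) //= ltr_pwDl // ?p0 //.
by apply: sumr_ge0 => k _; rewrite ltW.
Qed.

Lemma wratio_gt0 w : 0 < wprod r w. Proof. exact: wprod_gt0. Qed.

Lemma wratio_le1 w : wprod r w <= 1. Proof. exact: wprod_le1. Qed.

Lemma wweight_gt0 w : 0 < wprod p w.
Proof. by apply: wprod_gt0; exact: weight_gt0 H. Qed.

Lemma wweight_le1 w : wprod p w <= 1.
Proof. by apply: wprod_le1; exact: weight01. Qed.

Lemma wmap_sim w : similarity (wprod r w) (wmap S w).
Proof. by apply: wmap_similarity; exact: simS H. Qed.

Lemma wmap_continuous w : continuous (wmap S w).
Proof. exact: similarity_continuous (wratio_gt0 w) (wmap_sim w). Qed.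

Lemma attractorE : K = \bigcup_i (S i @` K).
Proof. by have [] := attractor H. Qed.

Lemma wmap_attractor w y : K y -> K (wmap S w y).
Proof.
by move=> Ky; elim: w => //= i w IH; rewrite attractorE; exists i => //; exists (wmap S w y).
Qed.

Lemma cyl_sub v w : cyl S K (v ++ w) `<=` cyl S K v.
Proof.
by move=> _ [y Ky <-]; rewrite wmap_cat; exists (wmap S w y) => //; exact: wmap_attractor.
Qed.

Lemma cyl_prefix v w : prefix v w -> cyl S K w `<=` cyl S K v.
Proof. by case/prefixP=> x ->; exact: cyl_sub. Qed.

Lemma cyl_attractor w : cyl S K w `<=` K.
Proof. by move=> _ [y Ky <-]; exact: wmap_attractor. Qed.

Lemma attractor_cut b y : 0 < b -> K y -> exists2 w, stop r b w & cyl S K w y.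
Proof.
move=> b0; move: b b0 y; apply: (stop_ind r01) => [b b1|b b0 b1 IH] y Ky.
  by exists [::] => //; exists y.
have [i _ [z Kz <-]] : (\bigcup_i (S i @` K)) y by rewrite -attractorE.
have [w sw [t Kt <-]] := IH i z Kz.
by exists (i :: w); [rewrite /= b1|exists t].
Qed.

Lemma attractor_nonempty : K !=set0. Proof. by have [] := attractor H. Qed.

Lemma attractor_compact : compact K. Proof. by have [] := attractor H. Qed.

Lemma attractor_closed : closed K.
Proof. exact: compact_closed_rV attractor_compact. Qed.

Lemma cyl_closed w : closed (cyl S K w).
Proof.
apply: compact_closed_rV; apply: continuous_compact; last exact: attractor_compact.
by apply: continuous_subspaceT; exact: wmap_continuous.
Qed.

Lemma cyl_diam : exists2 D : R, 0 < D &
  forall w y z, cyl S K w y -> cyl S K w z -> enorm (y - z) <= D * wprod r w.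
Proof.
have [D D0 KD] := compact_enorm attractor_compact.
exists D => // w _ _ [y Ky <-] [z Kz <-].
by rewrite wmap_sim mulrC ler_wpM2r ?KD // ltW // wratio_gt0.
Qed.

End System.
(** * Counting cylinders under the open set condition *)

Section Counting.
Context (R : realType) (d N : nat).
Context (S : 'I_N -> 'rV[R]_d -> 'rV[R]_d) (r p : 'I_N -> R).
Context (K : set 'rV[R]_d) (mu : probability (borel_rV R d) R).
Hypothesis H : osc_system S r p K mu.
Implicit Types (v w x : seq 'I_N) (y z : 'rV[R]_d).

Let r01 := ratio01 H.
Let r_gt0 := ratio_gt0 H.
Let rho_gt0 := wratio_gt0 H.

Lemma open_set_disjoint (U : set 'rV[R]_d) b v w y z :
  \bigcup_i (S i @` U) `<=` U ->
  (forall i j : 'I_N, i != j -> (S i @` U) `&` (S j @` U) = set0) ->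
  stop r b v -> stop r b w -> U y -> U z -> wmap S v y = wmap S w z -> v = w.
Proof.
move=> SU dU + + Uy Uz.
have wU x t : U t -> U (wmap S x t).
  by move=> Ut; elim: x => //= i x IH; apply: SU; exists i => //; exists (wmap S x t).
elim: v b w => [|i v IH] b [|j w] //=.
- by move=> b1; rewrite ltNge b1.
- by move=> /andP[+ _] b1; rewrite ltNge b1.
case/andP=> _ sv /andP[_ sw] e; have [ij|ij] := eqVneq i j.
  rewrite ij in e sv *; congr cons; apply: IH sv sw _.
  exact: similarity_inj (r_gt0 j) (simS H j) _ _ e.
have : ((S i @` U) `&` (S j @` U)) (S i (wmap S v y)).
  split; first by exists (wmap S v y) => //; exact: wU.
  by rewrite e; exists (wmap S w z) => //; exact: wU.
by rewrite dU.
Qed.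

(** The images of the open set under the maps of [cut b] are disjoint and
    contain balls of radius comparable to [b] around the images of a fixed
    point, so that those centres are separated. *)
Lemma count_cylinders (C : R) : 0 <= C -> exists M : nat,
  forall b z (s : seq (seq 'I_N)), 0 < b -> b <= 1 -> uniq s ->
  (forall v, v \in s -> stop r b v /\
     exists2 y, cyl S K v y & enorm (y - z) <= C * b) ->
  (size s <= M)%N.
Proof.
move=> C0; have [U [oU [u0 Uu0] _ SU dU]] := open_set H.
have [c c0 cU] := open_eball oU Uu0.
have [c' [c'0 c'1 c'r]] := fin_inf_gt0 r_gt0.
have [k0 Kk0] := attractor_nonempty H.
have [D D0 KD] := compact_enorm (attractor_compact H).
pose E := enorm (u0 - k0) + D + C.
have E0 : 0 <= E by rewrite !addr_ge0 ?enorm_ge0 // ltW.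
have [M hM] := packing d E0 (mulr_gt0 c0 c'0).
exists M => b z s b0 b1 us hs; apply: (hM _ s (fun v => wmap S v u0) z b) => //.
  move=> v /hs[sv [_ [y Ky <-] yz]].
  have := enorm_triangle (wmap S v u0) (wmap S v y) z; rewrite (wmap_sim H).
  have := enorm_triangle u0 k0 y; have := KD _ _ Kk0 Ky.
  have := stop_le r01 sv; have := rho_gt0 v; have := enorm_ge0 (u0 - y).
  by rewrite /E; nra.
move=> v w /hs[sv _] /hs[sw _] vw; rewrite leNgt; apply/negP => lt.
have [t tE] := similarity_surj (rho_gt0 v) (wmap_sim H v) (wmap S w u0).
have Ut : U t.
  apply: cU; rewrite enormC; move: lt; rewrite -tE (wmap_sim H) => lt.
  have := stop_ge r01 c'1 c'r b1 b0 sv => vb.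
  have : wprod r v * enorm (u0 - t) <= wprod r v * c by nra.
  by rewrite ler_pM2l // rho_gt0.
by move/eqP: vw; apply; exact: open_set_disjoint SU dU sv sw Ut Uu0 tE.
Qed.

(** A word [u] is a buffer if every cylinder [x ++ u] keeps a distance
    comparable to its size from all cylinders of its generation that lie
    outside the cylinder [x]. *)
Definition buffer u := forall x v y z,
  cyl S K (x ++ u) y -> stop r (wprod r (x ++ u)) v -> cyl S K v z ->
  enorm (y - z) <= wprod r (x ++ u) -> prefix x v.

(** Schief's argument: prepending [x] embeds the neighbours of [u] into those
    of [x ++ u], so a word with the largest number of neighbours gains no new
    ones, and all the neighbours of [x ++ u] start with [x]. *)
Lemma buffer_exists : exists u, buffer u.
Proof.
pose near w v := exists2 y, cyl S K w y &
  exists2 z, cyl S K v z & enorm (y - z) <= wprod r w.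
pose G w := [seq v <- cut r (wprod r w) | `[< near w v >]].
have G_uniq w : uniq (G w) by rewrite filter_uniq // cut_uniq.
have memG w v : v \in G w <-> stop r (wprod r w) v /\ near w v.
  rewrite mem_filter mem_cut //; split => [/andP[/asboolP]//|[-> h]].
  by rewrite andbT; apply/asboolP.
have [k0 Kk0] := attractor_nonempty H.
have [D D0 KD] := cyl_diam H.
have D1 : 0 <= D + 1 by rewrite addr_ge0 // ltW.
have [M hM] := count_cylinders D1.
have GM w : (size (G w) <= M)%N.
  apply: (hM (wprod r w) (wmap S w k0)) => //; first exact: (wratio_le1 H).
  move=> v /memG[sv [y wy [z vz yz]]]; split => //; exists z => //.
  have wk : cyl S K w (wmap S w k0) by exists k0.
  have := KD _ _ _ wy wk; have := enorm_triangle z y (wmap S w k0).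
  by rewrite (enormC z y); lra.
have ex : exists n, `[< exists w, size (G w) = n >].
  by exists (size (G [::])); apply/asboolP; exists [::].
have ub n : `[< exists w, size (G w) = n >] -> (n <= M)%N.
  by move=> /asboolP[w <-].
case: (ex_maxnP ex ub) => m /asboolP[u um] umax; exists u.
move=> x v y z xuy sv vz yz.
have [x0|x0] := eqVneq x [::]; first by rewrite x0 prefix0s.
have vG : v \in G (x ++ u) by apply/memG; split => //; exists y => //; exists z.
have sub : {subset [seq x ++ t | t <- G u] <= G (x ++ u)}.
  move=> _ /mapP[t /memG[st [a ua [b tb ab]]] ->]; apply/memG; split.
    rewrite wprod_cat; apply: (stop_cat r01) => //; first exact: (wratio_le1 H).
  exists (wmap S x a); first by case: ua => a' Ka' <-; exists a' => //; rewrite wmap_cat.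
  exists (wmap S x b); first by case: tb => b' Kb' <-; exists b' => //; rewrite wmap_cat.
  by rewrite (wmap_sim H) wprod_cat ler_pM2l // rho_gt0.
have us : uniq [seq x ++ t | t <- G u].
  rewrite map_inj_uniq // => a b /eqP; rewrite eqseq_cat // => /andP[_ /eqP].
  by [].
have le : (size (G (x ++ u)) <= size [seq x ++ t | t <- G u])%N.
  by rewrite size_map um; apply: umax; apply/asboolP; exists (x ++ u).
have [_ eqi] := uniq_min_size us sub le.
by move: vG; rewrite -eqi => /mapP[t _ ->]; exact: prefix_prefix.
Qed.

End Counting.
(** * Masses of balls *)

Section Masses.
Context (R : realType) (d N : nat).
Context (S : 'I_N -> 'rV[R]_d -> 'rV[R]_d) (r p : 'I_N -> R).
Context (K : set 'rV[R]_d) (mu : probability (borel_rV R d) R).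
Hypothesis H : osc_system S r p K mu.
Implicit Types (v w x : seq 'I_N) (y z : 'rV[R]_d) (A : set 'rV[R]_d).

Let r01 := ratio01 H.
Let r_gt0 := ratio_gt0 H.
Let rho_gt0 := wratio_gt0 H.

Definition mass (A : set (borel_rV R d)) : R := fine (mu A).

Lemma open_measurable_rV A : open A -> measurable (A : set (borel_rV R d)).
Proof. by move=> oA; exact: sub_sigma_algebra. Qed.

Lemma closed_measurable_rV A : closed A -> measurable (A : set (borel_rV R d)).
Proof.
move=> cA; rewrite -[A]setCK; apply: measurableC; apply: open_measurable_rV.
exact: closed_openC.
Qed.

Lemma massE A : closed A -> mu A = (mass A)%:E.
Proof. by move=> /closed_measurable_rV mA; rewrite fineK ?fin_num_measure. Qed.

Lemma mass_ge0 A : closed A -> 0 <= mass A.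
Proof. by move=> cA; rewrite -lee_fin -massE. Qed.

Lemma mass_le1 A : closed A -> mass A <= 1.
Proof.
move=> cA; rewrite -lee_fin -massE //; apply: probability_le1.
exact: closed_measurable_rV.
Qed.

Lemma le_mass A B : closed A -> closed B -> A `<=` B -> mass A <= mass B.
Proof.
move=> cA cB AB; rewrite -lee_fin -!massE //; apply: le_measure => //;
  by rewrite inE; exact: closed_measurable_rV.
Qed.

Lemma closed_preim w A : closed A -> closed (wmap S w @^-1` A).
Proof. by move=> cA; apply: preimage_closed => // y _; exact: (wmap_continuous H). Qed.

Lemma mass_step A : closed A -> mass A = \sum_i p i * mass (S i @^-1` A).
Proof.
move=> cA; apply: EFin_inj; rewrite -massE // (invariant_mu H); last first.
  exact: closed_measurable_rV.
rewrite -sumEFin; apply: eq_bigr => i _; rewrite EFinM massE //.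
exact: (@closed_preim [:: i]).
Qed.

Lemma mass_cut b A : 0 < b -> closed A ->
  mass A = \sum_(w <- cut r b) wprod p w * mass (wmap S w @^-1` A).
Proof.
move=> b0; move: b b0 A; apply: (stop_ind r01) => [b b1|b b0 b1 IH] A cA.
  by rewrite cut_ge1 // wprod_nil mul1r.
rewrite cut_rec // mass_step //; apply: eq_bigr => i _.
rewrite (IH i); last exact: (@closed_preim [:: i]).
by rewrite mulr_sumr; apply: eq_bigr => w _; rewrite wprod_cons mulrA.
Qed.

(** The similarities contract distances to the attractor, so by invariance
    the mass at distance at least [e] is at most the mass at distance at least
    [e / c ^ n], for every [n]. *)
Lemma mass_far (e : R) : 0 < e -> mass (~` nbhd K e) = 0.
Proof.
move=> e0; have [c [c0 c1 rc]] := fin_sup_lt1 r01.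
have cl t : closed (~` nbhd K t) by apply: open_closedC; exact: open_nbhd.
have step t : 0 < t -> mass (~` nbhd K t) <= mass (~` nbhd K (t / c)).
  move=> t0; rewrite mass_step // -[leRHS]mul1r -(weight_sum H) mulr_suml.
  apply: ler_sum => i _; rewrite ler_wpM2l ?(ltW (weight_gt0 H i)) //.
  apply: le_mass => //; first exact: (@closed_preim [:: i]).
  move=> y /= yt [k Kk yk]; apply: yt; exists (S i k).
    exact: (wmap_attractor H [:: i] Kk).
  rewrite (simS H) mulrC -ltr_pdivlMr //; apply: lt_le_trans yk _.
  by rewrite ler_pM2l // lef_pV2 ?posrE.
pose F n : set (borel_rV R d) := ~` nbhd K (e / c ^+ n).
have en n : 0 < e / c ^+ n by rewrite divr_gt0 ?exprn_gt0.
have eF n : mass (~` nbhd K e) <= mass (F n).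
  elim: n => [|n IH]; first by rewrite /F expr0 divr1.
  by apply: le_trans IH _; rewrite /F exprSr invfM mulrA; exact: step.
have F0 : \bigcap_n F n = set0.
  apply/seteqP; split => // y Fy; have [k Kk] := attractor_nonempty H.
  pose D := enorm (y - k) + 1; have D0 : 0 < D by rewrite ltr_wpDl ?enorm_ge0.
  have [n nD] := expr_small c0 c1 (divr_gt0 e0 D0).
  apply: (Fy n) => //; exists k => //; rewrite ltr_pdivlMr ?exprn_gt0 //.
  move: nD; rewrite ltr_pdivlMr // mulrC; apply: le_lt_trans.
  by rewrite ler_pM2r ?exprn_gt0 // lerDl.
have : mu (F n) @[n --> \oo] --> mu (\bigcap_n F n).
  apply: nonincreasing_cvg_mu => [|n||m n mn].
  - apply: le_lt_trans (probability_le1 _ _) (ltry _).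
    by apply: closed_measurable_rV; exact: cl.
  - by apply: closed_measurable_rV; exact: cl.
  - by rewrite F0.
  - apply/subsetPset; apply: subsetC => y [k Kk yk]; exists k => //.
    apply: lt_le_trans yk _; rewrite ler_pM2l // lef_pV2 ?posrE ?exprn_gt0 //.
    by rewrite ler_wiXn2l // ltW.
rewrite F0 measure0 => cv; apply/eqP; rewrite eq_le mass_ge0 // andbT.
have : ((mass (~` nbhd K e))%:E <= lim (mu (F n) @[n --> \oo]))%E.
  apply: lime_ge; first by apply/cvg_ex; eexists; exact: cv.
  by apply: nearW => n; rewrite [X in (_ <= X)%E]massE ?lee_fin //; exact: cl.
by rewrite (cvg_lim _ cv) // lee_fin.
Qed.

Lemma mass_attractor : mass K = 1.
Proof.
pose F n : set (borel_rV R d) := nbhd K n.+1%:R^-1.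
have mF n : measurable (F n) by apply: open_measurable_rV; exact: open_nbhd.
have muF n : mu (F n) = 1%E.
  have := probability_setC mu (mF n).
  have cl : closed (~` F n) by apply: open_closedC; exact: open_nbhd.
  rewrite massE // mass_far // => /esym/eqP.
  by rewrite sube_eq ?fin_num_measure // add0e => /eqP.
have FK : \bigcap_n F n = K.
  apply/seteqP; split => y; last first.
    by move=> Ky n _; exists y; rewrite ?subrr ?enorm0 ?invr_gt0.
  move=> Fy; apply: (closed_nbhd (attractor_closed H)) => e e0.
  have [n _ ne] : \forall n \near \oo, n.+1%:R^-1 < e :> R.
    exact: near_infty_natSinv_lt (PosNum e0).
  by have [k Kk yk] := Fy n I; exists k => //; apply: lt_trans yk _; exact: (ne n (leqnn n)).
have : mu (F n) @[n --> \oo] --> mu (\bigcap_n F n).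
  apply: nonincreasing_cvg_mu => // [||m n mn].
  - by apply: le_lt_trans (probability_le1 _ _) (ltry _).
  - by rewrite FK; exact: closed_measurable_rV (attractor_closed H).
  - apply/subsetPset => y [k Kk yk]; exists k => //.
    by apply: lt_le_trans yk _; rewrite lef_pV2 ?posrE // ler_nat.
rewrite FK; under eq_fun do rewrite muF.
move=> cv; have /(cvg_lim (@ereal_hausdorff R)) := cv.
rewrite lim_cst // massE; last exact: attractor_closed H.
by move=> [<-].
Qed.

Lemma mass_disjoint A : closed A -> A `&` K = set0 -> mass A = 0.
Proof.
move=> cA AK; have cK := attractor_closed H.
have : mu (A `|` K) = (mu A + mu K)%E.
  by apply: measureU => //; exact: closed_measurable_rV.
rewrite !massE ?mass_attractor //; last exact: closedU.
move=> [e]; apply/eqP; rewrite eq_le mass_ge0 // andbT.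
by have := mass_le1 (closedU cA cK); rewrite e; lra.
Qed.

(** The attractor has full mass, so a map whose cylinder misses [A] pulls
    [A] back to a null set. *)
Lemma mass_le_cylinders b A (P : pred (seq 'I_N)) : 0 < b -> closed A ->
  (forall w y, stop r b w -> cyl S K w y -> A y -> P w) ->
  mass A <= \sum_(w <- cut r b | P w) wprod p w.
Proof.
move=> b0 cA hP; rewrite (mass_cut b0 cA) [leRHS]big_mkcond /=.
rewrite big_seq [leRHS]big_seq; apply: ler_sum => w; rewrite mem_cut // => sw.
case: ifPn => Pw.
  by rewrite ler_piMr ?mass_le1 ?(ltW (wweight_gt0 H w)) //; exact: closed_preim.
rewrite mass_disjoint ?mulr0 //; first exact: closed_preim.
apply/seteqP; split => // y [Ay Ky]; move/negP: Pw; apply.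
by apply: (hP w (wmap S w y)) => //; exists y.
Qed.

Lemma weight_le_mass w A : closed A -> cyl S K w `<=` A -> wprod p w <= mass A.
Proof.
elim: w A => [|i w IH] A cA wA.
  rewrite wprod_nil -mass_attractor; apply: le_mass => //.
    exact: attractor_closed H.
  by move=> y Ky; apply: wA; exists y.
rewrite wprod_cons mass_step //; apply: le_trans (_ : p i * mass (S i @^-1` A) <= _).
  rewrite ler_pM2l ?(weight_gt0 H) //; apply: IH.
    exact: (@closed_preim [:: i]).
  by move=> _ [y Ky <-]; apply: wA; exists y.
rewrite (bigD1 i) //= lerDl; apply: sumr_ge0 => j _.
rewrite mulr_ge0 ?(ltW (weight_gt0 H j)) // mass_ge0 //.
exact: (@closed_preim [:: j]).
Qed.

(** A cylinder through the centre has a descendant, a bounded number of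
    generations below it, that fits into the ball. *)
Lemma mass_ball_lower : exists2 c : R, 0 < c & forall w y (rho : R),
  cyl S K w y -> wprod r w <= rho -> c * wprod p w <= mass (closed_eball y rho).
Proof.
have [D D0 KD] := cyl_diam H.
have D1 : 0 < (D + 1)^-1 by rewrite invr_gt0; lra.
exists (\big[Num.min/1]_(v <- cut r (D + 1)^-1) wprod p v).
  by apply: lt_bigmin => // v _; exact: wweight_gt0 H v.
move=> w y rho [k Kk ky] rw; have [v sv vk] := attractor_cut H D1 Kk.
apply: le_trans (_ : wprod p (w ++ v) <= _).
  rewrite wprod_cat mulrC ler_pM2l ?(wweight_gt0 H) //.
  by apply: ge_bigmin_seq; rewrite ?mem_cut.
apply: weight_le_mass; first exact: closed_closed_eball.
have wvy : cyl S K (w ++ v) y.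
  by case: vk => t Kt tk; exists t => //; rewrite wmap_cat tk.
move=> z wvz; rewrite /closed_eball /=; apply: le_trans (KD _ _ _ wvz wvy) _.
rewrite wprod_cat; apply: le_trans rw; rewrite mulrCA ler_piMr //.
  exact: ltW.
have := stop_le r01 sv; rewrite -[(D + 1)^-1]div1r ler_pdivlMr; last lra.
by have := rho_gt0 v; nra.
Qed.

(** A ball meets boundedly many cylinders of its own size. *)
Lemma mass_ball_upper : exists2 M : R, 1 <= M & forall y (rho t : R),
  0 < rho -> rho <= 1 -> 0 <= t ->
  (forall v z, stop r rho v -> cyl S K v z -> enorm (z - y) <= rho ->
     wprod p v <= t) ->
  mass (closed_eball y rho) <= M * t.
Proof.
have [M hM] := count_cylinders H ler01.
exists M.+1%:R; first by rewrite ler1n.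
move=> y rho t rho0 rho1 t0 ht.
pose P v := `[< exists2 z, cyl S K v z & enorm (z - y) <= rho >].
apply: le_trans (mass_le_cylinders (P := P) rho0 _ _) _.
- exact: closed_closed_eball.
- by move=> w z sw wz zy; apply/asboolP; exists z.
rewrite -big_filter; apply: le_trans (_ : \sum_(v <- [seq v <- cut r rho | P v]) t <= _).
  rewrite big_seq [leRHS]big_seq; apply: ler_sum => v.
  rewrite mem_filter mem_cut // => /andP[/asboolP[z vz zy] sv].
  exact: ht sv vz zy.
rewrite big_const_seq count_predT iter_addr_0 -[leLHS]mulr_natl ler_wpM2r //.
rewrite ler_nat leqW //; apply: (hM rho y) => //; first by rewrite filter_uniq // cut_uniq.
move=> v; rewrite mem_filter mem_cut // => /andP[/asboolP[z vz zy] sv].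
by split => //; exists z; rewrite ?mul1r.
Qed.

End Masses.
(** * The function beta and its Legendre transform *)

Lemma exp_tangent (R : realType) (a c : R) :
  expR c * (1 + (a - c)) <= expR a.
Proof.
rewrite -[X in _ <= expR X](subrK c a) expRD mulrC ler_pM2r ?expR_gt0 //.
exact: expR_ge1Dx.
Qed.

Lemma expR_convex2 (R : realType) (u v a b : R) : 0 <= u -> 0 <= v ->
  u + v = 1 -> expR (u * a + v * b) <= u * expR a + v * expR b.
Proof.
move=> u0 v0 uv; set c := u * a + v * b.
have ha := exp_tangent a c; have hb := exp_tangent b c.
have -> : expR c = u * (expR c * (1 + (a - c))) + v * (expR c * (1 + (b - c))).
  have vE : v = 1 - u by rewrite -uv; ring.
  by rewrite /c vE; ring.
by rewrite lerD // ler_wpM2l.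
Qed.

Lemma expR_le_quadratic (R : realType) (y : R) : `|y| <= 2^-1 ->
  expR y <= 1 + y + 2 * y ^+ 2.
Proof.
rewrite ler_norml => /andP[y1 y2].
have h := expR_ge1Dx (- y); have e0 := expR_gt0 y.
have e1 : expR y * expR (- y) = 1 by rewrite -expRD subrr expR0.
have {h} : expR y * (1 - y) <= 1 by rewrite -[leRHS]e1 ler_pM2l.
move=> h; have y3 : 0 < 1 - y by lra.
rewrite -(ler_pM2r y3); apply: le_trans h _.
have -> : (1 + y + 2 * y ^+ 2) * (1 - y) = 1 + y ^+ 2 * (1 - 2 * y) by ring.
by rewrite lerDl mulr_ge0 ?sqr_ge0 //; lra.
Qed.

(** The derivative at [t = 0] of the moment [\sum_i P i * expR (t * x i)] is
    the mean of [x]. *)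
Lemma exp_moment_lt1 (R : realType) (I : finType) (P x : I -> R) :
  (forall i, 0 <= P i) -> \sum_i P i = 1 -> \sum_i P i * x i < 0 ->
  exists2 t, 0 < t & \sum_i P i * expR (t * x i) < 1.
Proof.
move=> P0 P1; set m := \sum_i _ => m0.
pose V := \sum_i P i * x i ^+ 2; pose X := \sum_i `|x i|.
have V0 : 0 <= V by apply: sumr_ge0 => i _; rewrite mulr_ge0 ?sqr_ge0.
have X0 : 0 <= X by apply: sumr_ge0.
pose D := 2 * X + 2 * (V / - m) + 1.
have Vm : 0 <= V / - m by rewrite divr_ge0 // oppr_ge0 ltW.
have D0 : 0 < D by rewrite /D; lra.
exists D^-1; first by rewrite invr_gt0.
apply: (@le_lt_trans _ _ (\sum_i (P i + D^-1 * (P i * x i)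
    + 2 * D^-1 ^+ 2 * (P i * x i ^+ 2)))).
  apply: ler_sum => i _.
  have -> : P i + D^-1 * (P i * x i) + 2 * D^-1 ^+ 2 * (P i * x i ^+ 2) =
    P i * (1 + D^-1 * x i + 2 * (D^-1 * x i) ^+ 2) by ring.
  rewrite ler_wpM2l //; apply: expR_le_quadratic.
  rewrite normrM gtr0_norm ?invr_gt0 // mulrC ler_pdivrMr //.
  have : `|x i| <= X by rewrite /X (bigD1 i) //= lerDl sumr_ge0.
  by rewrite /D; lra.
rewrite !big_split /= -!mulr_sumr P1 -/m -/V.
have -> : 1 + D^-1 * m + 2 * D^-1 ^+ 2 * V = 1 + D^-1 * (m + 2 * V / D).
  by field; rewrite gt_eqF.
rewrite gtrDl pmulr_rlt0 ?invr_gt0 //; suff : 2 * V / D < - m by lra.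
rewrite ltr_pdivrMr // [ltRHS]mulrC -ltr_pdivrMr ?oppr_gt0 //.
by rewrite /D -mulrA; lra.
Qed.

Section Beta.
Context (R : realType) (N : nat) (r p : 'I_N -> R) (beta : R -> R).
Hypotheses (r01 : forall i, 0 < r i < 1) (p01 : forall i, 0 < p i < 1).
Hypothesis betaE : forall q : R, \sum_(i < N) (p i `^ q * r i `^ beta q) = 1.
Implicit Types q t : R.

Definition exponent i : R := ln (p i) / ln (r i).

(** The members of the family of probability vectors given by the equation
    for beta. *)
Definition gibbs q i : R := expR (q * ln (p i) + beta q * ln (r i)).

Let r_gt0 i : 0 < r i. Proof. by have /andP[] := r01 i. Qed.
Let p_gt0 i : 0 < p i. Proof. by have /andP[] := p01 i. Qed.
Lemma ln_ratio_lt0 i : ln (r i) < 0.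
Proof. by have /andP[? ?] := r01 i; rewrite ln_lt0 // r_gt0. Qed.
Let lr0 := ln_ratio_lt0.
Let lp0 i : ln (p i) < 0.
Proof. by have /andP[? ?] := p01 i; rewrite ln_lt0 // p_gt0. Qed.

Lemma exponentE i : ln (p i) = exponent i * ln (r i).
Proof. by rewrite divfK // lt_eqF. Qed.

Lemma exponent_gt0 i : 0 < exponent i.
Proof. by rewrite /exponent -mulrNN -invrN divr_gt0 ?oppr_gt0. Qed.

Lemma gibbsE q i : gibbs q i = p i `^ q * r i `^ beta q.
Proof. by rewrite /gibbs /powR !gt_eqF // expRD. Qed.

Lemma gibbs_sum q : \sum_i gibbs q i = 1.
Proof. by rewrite -[RHS](betaE q); apply: eq_bigr => i _; exact: gibbsE. Qed.

Lemma gibbs_gt0 q i : 0 < gibbs q i. Proof. exact: expR_gt0. Qed.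

Lemma gibbs_le1 q i : gibbs q i <= 1.
Proof.
rewrite -(gibbs_sum q) (bigD1 i) //= lerDl.
by apply: sumr_ge0 => j _; rewrite ltW // gibbs_gt0.
Qed.

Lemma index_inhabited : 'I_N.
Proof.
case: N r p beta r01 p01 betaE => [r' p' b' _ _ bE|n *]; last exact: ord0.
by have := bE 0; rewrite big_ord0 => /esym/eqP; rewrite oner_eq0.
Qed.

Lemma beta_le q t :
  \sum_i expR (q * ln (p i) + t * ln (r i)) <= 1 -> beta q <= t.
Proof.
move=> h; rewrite leNgt; apply/negP => tb; move: h; apply/negP; rewrite -ltNge.
rewrite -(gibbs_sum q); apply: ltr_sum; last first.
  by move=> i _; rewrite ltr_expR ltrD2l ltr_nM2r.
by apply/hasP; exists index_inhabited; rewrite ?mem_index_enum.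
Qed.

Lemma beta_ge q t :
  1 <= \sum_i expR (q * ln (p i) + t * ln (r i)) -> t <= beta q.
Proof.
move=> h; rewrite leNgt; apply/negP => tb; move: h; apply/negP; rewrite -ltNge.
rewrite -(gibbs_sum q); apply: ltr_sum; last first.
  by move=> i _; rewrite ltr_expR ltrD2l ltr_nM2r.
by apply/hasP; exists index_inhabited; rewrite ?mem_index_enum.
Qed.

Lemma beta_convex u v q1 q2 : 0 <= u -> 0 <= v -> u + v = 1 ->
  beta (u * q1 + v * q2) <= u * beta q1 + v * beta q2.
Proof.
move=> u0 v0 uv; apply: beta_le; rewrite -uv.
rewrite -[u in leRHS]mulr1 -[v in leRHS]mulr1 -{1}(gibbs_sum q1) -(gibbs_sum q2).
rewrite !mulr_sumr -big_split /=; apply: ler_sum => i _.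
apply: le_trans (expR_convex2 _ _ u0 v0 uv).
by rewrite ler_expR le_eqVlt; apply/orP; left; apply/eqP; ring.
Qed.

Section Extremes.
Variables (A B : R).
Hypothesis AB : forall i, A <= exponent i <= B.

(** Raising [q] by [t] multiplies the [i]-th term by [p i ^ t], a power of [r i]
    with exponent between [A * t] and [B * t], which [beta] has to offset. *)
Lemma beta_slope_le q t : 0 <= t -> beta (q + t) <= beta q - A * t.
Proof.
move=> t0; apply: beta_le; rewrite -(gibbs_sum q); apply: ler_sum => i _.
rewrite ler_expR exponentE; have /andP[h _] := AB i.
have : t * (exponent i - A) * ln (r i) <= 0.
  by rewrite mulr_ge0_le0 ?mulr_ge0 ?subr_ge0 // ltW.
by nra.
Qed.

Lemma beta_slope_ge q t : 0 <= t -> beta q - B * t <= beta (q + t).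
Proof.
move=> t0; apply: beta_ge; rewrite -(gibbs_sum q); apply: ler_sum => i _.
rewrite ler_expR exponentE; have /andP[_ h] := AB i.
have : t * (B - exponent i) * ln (r i) <= 0.
  by rewrite mulr_ge0_le0 ?mulr_ge0 ?subr_ge0 // ltW.
by nra.
Qed.

Lemma beta_continuous : continuous beta.
Proof.
move=> q; apply/cvgrPdist_le => e e0.
pose L := `|A| + `|B| + 1; have L0 : 0 < L by rewrite ltr_wpDl ?addr_ge0.
have A1 := ler_norm A; have A2 := ler_norm (- A); rewrite normrN in A2.
have B1 := ler_norm B; have B2 := ler_norm (- B); rewrite normrN in B2.
have A0 := normr_ge0 A; have B0 := normr_ge0 B.
have lip0 x y : x <= y -> `|beta x - beta y| <= (y - x) * L.
  move=> xy; have yx0 : 0 <= y - x by rewrite subr_ge0.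
  have := beta_slope_le x yx0; have := beta_slope_ge x yx0.
  rewrite (_ : x + (y - x) = y); last by ring.
  by move=> h1 h2; rewrite ler_norml /L; nra.
have lip t : `|q - t| <= e / L -> `|beta q - beta t| <= e.
  rewrite ler_pdivlMr // => qt; apply: le_trans qt.
  have [h|/ltW h] := leP q t.
    by rewrite (distrC q) (ger0_norm (x := t - q)) ?subr_ge0 // lip0.
  by rewrite distrC (ger0_norm (x := q - t)) ?subr_ge0 // lip0.
near=> t; apply: lip; near: t; apply: cvgr_dist_le; first exact: cvg_id.
by rewrite divr_gt0.
Unshelve. all: by end_near. Qed.

End Extremes.

Lemma tangent_ge0_at q i : 0 <= exponent i * q + beta q.
Proof.
have := gibbs_le1 q i; rewrite -[X in _ <= X]expR0 ler_expR exponentE.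
have := lr0 i => h1 h2; have : (exponent i * q + beta q) * ln (r i) <= 0 by nra.
by rewrite nmulr_lle0.
Qed.

Section Extremal.
Variables (i0 i1 : 'I_N).
Hypothesis ext : forall i, exponent i0 <= exponent i <= exponent i1.

Lemma tangent_ge0 a q : exponent i0 <= a -> a <= exponent i1 ->
  0 <= a * q + beta q.
Proof.
move=> a0 a1; have h0 := tangent_ge0_at q i0; have h1 := tangent_ge0_at q i1.
by have [q0|q0] := leP 0 q; nra.
Qed.

(** The minimax exchange behind the upper bound: the constraints that the
    parameters [q > 0] and [q < 0] put on [al] are compatible because [beta]
    is convex. *)
Lemma legendre_minimax a b m : a <= b ->
  (forall q, m <= Num.max (a * q) (b * q) + beta q) ->
  exists al, [/\ a <= al, al <= b & forall q, m <= al * q + beta q].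
Proof.
move=> ab hm.
have hpos q : 0 < q -> (m - beta q) / q <= b.
  move=> q0; rewrite ler_pdivrMr //; have := hm q.
  by rewrite (max_idPr (ler_wpM2r (ltW q0) ab)); lra.
have hneg q : q < 0 -> a <= (m - beta q) / q.
  move=> q0; rewrite ler_ndivlMr //; have := hm q.
  by rewrite (max_idPl (ler_wnM2r (ltW q0) ab)); lra.
have h0 : m <= beta 0 by have := hm 0; rewrite !mulr0 maxxx add0r.
have hmix q1 q2 : q1 < 0 -> 0 < q2 -> (m - beta q2) / q2 <= (m - beta q1) / q1.
  move=> q10 q20; rewrite ler_ndivlMr // mulrAC ler_pdivlMr //.
  have D0 : 0 < q2 - q1 by lra.
  have := @beta_convex (q2 / (q2 - q1)) (- q1 / (q2 - q1)) q1 q2.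
  rewrite !divr_ge0 ?oppr_ge0 ?(ltW q10) ?(ltW q20) ?(ltW D0) //.
  rewrite -mulrDl divff ?gt_eqF // => /(_ isT isT erefl).
  have -> : q2 / (q2 - q1) * q1 + - q1 / (q2 - q1) * q2 = 0.
    by field; rewrite gt_eqF.
  move=> h; have {}h := le_trans h0 h.
  rewrite mulrAC (mulrAC (- q1)) -mulrDl ler_pdivlMr // in h.
  by nra.
pose X := [set t | t = a \/ exists2 q, 0 < q & t = (m - beta q) / q].
have Xb : ubound X b by move=> _ [->//|[q q0 ->]]; exact: hpos.
have X0 : X !=set0 by exists a; left.
have supX t : X t -> t <= sup X by move=> Xt; apply: ub_le_sup => //; exists b.
exists (sup X); split.
- by apply: supX; left.
- exact: ge_sup.
- move=> q; have [q0|q0|->] := ltgtP q 0; last by rewrite mulr0 add0r.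
    have : sup X <= (m - beta q) / q.
      by apply: ge_sup => // _ [->|[t t0 ->]]; [exact: hneg|exact: hmix].
    by rewrite ler_ndivlMr //; lra.
  have : (m - beta q) / q <= sup X by apply: supX; right; exists q.
  by rewrite ler_pdivrMr //; lra.
Qed.

(** Moving [al] slightly into the interior of the range of exponents makes
    [q |-> al * q + beta q] coercive, so that it has a minimizer; the minimum
    drops little because this function is nonnegative for each exponent. *)
Lemma legendre_minimizer al s e : exponent i0 <= al -> al <= exponent i1 ->
  (forall q, s <= al * q + beta q) -> 0 < e ->
  exists al' q0, [/\ `|al' - al| <= e,
    (forall q, al' * q0 + beta q0 <= al' * q + beta q) &
    s - e <= al' * q0 + beta q0].
Proof.
set A := exponent i0; set B := exponent i1; move=> Aal alB hs e0.
have AB : A <= B by lra.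
have [BA|{}AB] := leP B A.
  have alE : al = A by lra.
  have BE : B = A by lra.
  exists al, 0; split=> [|q|]; first by rewrite subrr normr0 ltW.
    rewrite mulr0 add0r alE; have [q0|q0] := leP 0 q.
      by have := beta_slope_ge ext 0 q0; rewrite add0r -/B BE; lra.
    have := beta_slope_le ext q (t := - q); rewrite subrr -/A oppr_ge0.
    by move=> /(_ (ltW q0)); lra.
  by have := hs 0; lra.
pose D := B - A + `|s| + 1; have s0 := normr_ge0 s; have sn := ler_norm s.
have D0 : 0 < D by rewrite /D; lra.
pose t := Num.min 2^-1 (e / D).
have t0 : 0 < t by rewrite lt_min invr_gt0 divr_gt0 // ltr0n.
have t1 : t <= 2^-1 by rewrite ge_min lexx.
have tD : t * D <= e by rewrite -ler_pdivlMr // ge_min lexx orbT.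
have tD' : t * (B - A) + t * `|s| <= e.
  by apply: le_trans tD; rewrite -mulrDr ler_wpM2l // ?(ltW t0) // /D; lra.
pose al' := (1 - t) * al + t * ((A + B) / 2).
have A' : A < al' by rewrite /al'; nra.
have B' : al' < B by rewrite /al'; nra.
pose f q := al' * q + beta q.
pose k := Num.min (al' - A) (B - al').
have k0 : 0 < k by rewrite lt_min !subr_gt0 A' B'.
have kA : k <= al' - A by rewrite ge_min lexx.
have kB : k <= B - al' by rewrite ge_min lexx orbT.
pose Q := beta 0 / k.
have b0 : 0 <= beta 0 by have := tangent_ge0_at 0 i0; rewrite mulr0 add0r.
have Q0 : 0 <= Q by rewrite divr_ge0 // ltW.
have QQ : - Q <= Q by lra.
have cf : {within `[- Q, Q], continuous f}.
  apply: continuous_subspaceT => x; apply: cvgD; last exact: beta_continuous ext _.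
  by apply: cvgM; [exact: cvg_cst|exact: cvg_id].
have [q0 _ hq0] := EVT_min QQ cf.
have fk q : k * `|q| <= f q.
  rewrite /f; have h0 := tangent_ge0_at q i0; have h1 := tangent_ge0_at q i1.
  by have [q1|q1] := leP 0 q; [rewrite ger0_norm|rewrite ltr0_norm] => //;
    rewrite -/A -/B in h0 h1; nra.
exists al', q0; split.
- rewrite (_ : al' - al = t * ((A + B) / 2 - al)); last by rewrite /al'; ring.
  rewrite normrM gtr0_norm //; apply: le_trans tD'.
  rewrite -[leLHS]addr0 lerD ?mulr_ge0 ?(ltW t0) // ler_wpM2l ?(ltW t0) //.
  by rewrite ler_norml; lra.
- move=> q; have [qQ|qQ] := leP `|q| Q.
    by apply: hq0; rewrite in_itv /= -ler_norml.
  apply: le_trans (hq0 0 _) _; first by rewrite in_itv /=; lra.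
  rewrite /f mulr0 add0r; apply: le_trans (fk q).
  by rewrite mulrC -ler_pdivrMr // ltW.
- have h := hs q0; have h2 : 0 <= (A + B) / 2 * q0 + beta q0.
    by apply: tangent_ge0; rewrite -/A -/B; lra.
  have -> : al' * q0 + beta q0 = (1 - t) * (al * q0 + beta q0) +
     t * ((A + B) / 2 * q0 + beta q0) by rewrite /al'; ring.
  have ts : t * s <= e.
    apply: le_trans tD'; rewrite -[leLHS]add0r lerD //; last by rewrite ler_wpM2l // ltW.
    by rewrite mulr_ge0 ?(ltW t0) //; lra.
  have : (1 - t) * s <= (1 - t) * (al * q0 + beta q0) by rewrite ler_wpM2l //; lra.
  have : 0 <= t * ((A + B) / 2 * q0 + beta q0) by rewrite mulr_ge0 // ltW.
  by lra.
Qed.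

End Extremal.

(** The first-order condition at a minimizer, read off the explicit sum that
    defines [beta]: a nonzero mean would give an exponential moment below 1,
    hence a point of the graph of [beta] below its tangent line. *)
Lemma gibbs_mean al q0 :
  (forall q, al * q0 + beta q0 <= al * q + beta q) ->
  \sum_i gibbs q0 i * (ln (p i) - al * ln (r i)) = 0.
Proof.
move=> hmin; set c := fun i => ln (p i) - al * ln (r i).
have moment t : 1 <= \sum_i gibbs q0 i * expR (t * c i).
  rewrite -(gibbs_sum (q0 + t)); apply: ler_sum => i _.
  rewrite -expRD ler_expR /c; have := hmin (q0 + t); have := lr0 i => h1 h2.
  have : (al * (q0 + t) + beta (q0 + t) - (al * q0 + beta q0)) * ln (r i) <= 0.
    by rewrite mulr_ge0_le0 ?subr_ge0 // ltW.
  by lra.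
have P0 i : 0 <= gibbs q0 i by rewrite ltW ?gibbs_gt0.
apply/eqP; rewrite eq_le !leNgt; apply/andP; split; apply/negP => h.
  have [|t t0] := exp_moment_lt1 (x := fun i => - c i) P0 (gibbs_sum q0).
    by under eq_bigr do rewrite mulrN; rewrite sumrN oppr_lt0.
  apply/negP; rewrite -leNgt; apply: le_trans (moment (- t)) _.
  by apply: ler_sum => i _; rewrite mulrN mulNr.
have [t t0] := exp_moment_lt1 P0 (gibbs_sum q0) h.
by apply/negP; rewrite -leNgt; exact: moment.
Qed.

End Beta.
(** * Null sets for the Hausdorff measures *)

Section Hausdorff.
Context (R : realType) (d : nat).
Implicit Types (A E : set 'rV[R]_d) (t delta eta : R).

Lemma diam_le A (D : R) :
  (forall x y, A x -> A y -> enorm (x - y) <= D) -> (diam A <= D%:E)%E.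
Proof. by move=> h; apply: ge_ereal_sup => _ [[x y] /= [Ax Ay] <-]; rewrite lee_fin h. Qed.

Lemma enorm_le_diam A x y : A x -> A y -> ((enorm (x - y))%:E <= diam A)%E.
Proof. by move=> Ax Ay; apply: ereal_sup_ubound; exists (x, y). Qed.

Lemma diam_set0 : diam (set0 : set 'rV[R]_d) = -oo%E.
Proof.
by rewrite /diam (_ : [set _ | _ in _] = set0) ?ereal_sup0 // set0X image_set0.
Qed.

Lemma diam_ge0 A : A !=set0 -> (0 <= diam A)%E.
Proof. by move=> [x Ax]; have := enorm_le_diam Ax Ax; rewrite subrr enorm0. Qed.

Lemma diam_pow_ge0 t A : (0 <= diam_pow t A)%E.
Proof. by rewrite /diam_pow; case: ifP => // _; exact: poweR_ge0. Qed.

Lemma diam_pow_set0 t : diam_pow t (set0 : set 'rV[R]_d) = 0%E.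
Proof. by rewrite /diam_pow eqxx. Qed.

Lemma diam_pow_le t A (D : R) : 0 <= t -> 0 <= D -> (diam A <= D%:E)%E ->
  (diam_pow t A <= (D `^ t)%:E)%E.
Proof.
move=> t0 D0 AD; rewrite /diam_pow; case: ifPn => [_|/set0P A0].
  by rewrite lee_fin powR_ge0.
rewrite -poweR_EFin gt0_ler_poweR //; rewrite in_itv /= ?lee_fin ?D0 ?leey //.
by rewrite diam_ge0 // leey.
Qed.

(** A set of diameter [D <= 1] weighs at least [D ^ t'] for every [t' > t];
    the larger exponent absorbs the conventions for the empty set and for
    [t = 0]. *)
Lemma diam_real (V : set 'rV[R]_d) (t t' delta : R) : 0 <= t -> t < t' ->
  0 < delta -> delta <= 1 -> (diam V <= delta%:E)%E ->
  exists D : R, [/\ 0 <= D, D <= delta, ((D `^ t')%:E <= diam_pow t V)%E &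
    forall x y, V x -> V y -> enorm (x - y) <= D].
Proof.
move=> t0 tt' delta0 delta1 Vd; have t'0 : 0 < t' by lra.
have [->|/set0P V0] := eqVneq V set0.
  by exists 0; split=> //; [exact: ltW|rewrite powR0 ?gt_eqF // diam_pow_set0].
have Vge := diam_ge0 V0.
have Vfin : diam V = (fine (diam V))%:E.
  rewrite fineK // ge0_fin_numE //; exact: le_lt_trans Vd (ltry _).
exists (fine (diam V)); rewrite -!lee_fin -Vfin; split=> //; last first.
  by move=> x y Vx Vy; rewrite -lee_fin -Vfin; exact: enorm_le_diam.
rewrite /diam_pow ifF; last by apply/eqP => V_0; case: V0 => x; rewrite V_0.
rewrite Vfin poweR_EFin lee_fin; set D := fine _.
have D0 : 0 <= D by rewrite -lee_fin -Vfin.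
have D1 : D <= 1 by rewrite -lee_fin -Vfin; apply: le_trans Vd _; rewrite lee_fin.
have [->|DN0] := eqVneq D 0; first by rewrite powR0 ?gt_eqF // powR_ge0.
have Dp : 0 < D by rewrite lt_def DN0.
by rewrite /powR !gt_eqF // ler_expR ler_wnM2r ?ln_le0 // ltW.
Qed.

Lemma nneseries_nth t (s : seq (set 'rV[R]_d)) :
  (\sum_(0 <= m <oo) diam_pow t (nth set0 s m) =
   \sum_(A <- s) diam_pow t A)%E.
Proof.
rewrite (nneseries_split 0 (size s)); last by move=> k _; exact: diam_pow_ge0.
rewrite add0n eseries0 ?adde0; first by rewrite (big_nth set0).
by move=> i si _; rewrite nth_default // diam_pow_set0.
Qed.

Lemma hausdorff_content_ge0 t delta E : (0 <= hausdorff_content t delta E)%E.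
Proof.
apply: le_ereal_inf_tmp => _ [U _ <-].
by apply: nneseries_ge0 => n _ _; exact: diam_pow_ge0.
Qed.

(** Covering the pieces of a countable decomposition, the [n]-th one at a cost
    of [eta / 2 ^ n.+1], and renumbering the double sequence of covering
    sets. *)
Lemma hausdorff_measure_bigcup0 t E (F : nat -> set 'rV[R]_d) :
  E `<=` \bigcup_n F n ->
  (forall n delta eta, 0 < delta -> 0 < eta ->
    exists s : seq (set 'rV[R]_d), [/\
      forall x, F n x -> exists2 A, A \in s & A x,
      forall A, A \in s -> (diam A <= delta%:E)%E &
      (\sum_(A <- s) diam_pow t A <= eta%:E)%E]) ->
  hausdorff_measure t E = 0%E.
Proof.
move=> EF cov; apply/eqP; rewrite eq_le; apply/andP; split; last first.
  apply: le_trans (hausdorff_content_ge0 t 1 E) _.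
  by apply: ereal_sup_ubound; exists 1 => //=.
apply: ge_ereal_sup => _ [delta /= delta0 <-].
apply/lee_addgt0Pr => eta eta0; rewrite add0e.
have eta_n n : 0 < eta / (2 ^ n.+1)%:R by rewrite divr_gt0 // ltr0n expn_gt0.
have [s hs] := choice (fun n => cov n delta _ delta0 (eta_n n)).
have : ([set: nat] #= [set: nat * nat])%card by rewrite card_eq_sym; exact: card_nat2.
move=> /card_set_bijP[f fbij].
pose g nm : \bar R := diam_pow t (nth set0 (s nm.1) nm.2).
have g0 nm : (0 <= g nm)%E by exact: diam_pow_ge0.
apply: (@le_trans _ _ (\sum_(0 <= k <oo) g (f k))%E).
  apply: ereal_inf_lbound; exists (fun k => nth set0 (s (f k).1) (f k).2) => //.
  split=> [x Ex|k].
    have [n _ Fx] := EF x Ex; have [h1 _ _] := hs n.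
    have [A As Ax] := h1 x Fx; have [_ _ fsurj] := fbij.
    have [k _ fk] := fsurj (n, index A (s n)) I.
    by exists k => //; rewrite fk /= nth_index.
  have [ks|ks] := ltnP (f k).2 (size (s (f k).1)).
    by have [_ h2 _] := hs (f k).1; apply: h2; exact: mem_nth.
  by rewrite nth_default // diam_set0 leNye.
rewrite (nneseries_esumT (a := fun k => g (f k))) //.
rewrite -(reindex_esum _ _ f g fbij).
have -> : [set: nat * nat] = [set: nat] `*`` (fun=> [set: nat]).
  by apply/seteqP; split => // -[].
rewrite -(esum_esum (a := fun n m => g (n, m))) //.
rewrite -(nneseries_esumT (a := fun n => \esum_(m in [set: nat]) g (n, m))); last first.
  by move=> n; apply: esum_ge0.
apply: le_trans (_ : (\sum_(0 <= n <oo) (0 + (eta / (2 ^ n.+1)%:R)%:E) <= _)%E).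
  apply: lee_nneseries => [n _ _|n _]; first exact: esum_ge0.
  rewrite -(nneseries_esumT (a := fun m => g (n, m))) // add0e.
  by rewrite (nneseries_nth t (s n)); have [] := hs n.
apply: le_trans (epsilon_trick (A := fun=> 0%E) xpredT _ (ltW eta0)) _ => //.
by rewrite eseries0 ?add0e.
Qed.

End Hausdorff.
(** * The upper bound *)

Lemma powR_small (R : realType) (g k eta : R) : 0 < g -> 0 < k -> 0 < eta ->
  exists2 rho, 0 < rho & forall t, 0 <= t -> t <= rho -> k * t `^ g <= eta.
Proof.
move=> g0 k0 eta0; have ek : 0 < eta / k by rewrite divr_gt0.
exists ((eta / k) `^ g^-1); first by rewrite powR_gt0.
move=> t t0 tr; rewrite -ler_pdivlMl // mulrC.
have -> : eta / k = ((eta / k) `^ g^-1) `^ g.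
  by rewrite -powRrM mulVf ?gt_eqF // powRr1 // ltW.
by rewrite ge0_ler_powR // ?nnegrE ?(ltW g0) ?powR_ge0.
Qed.

(** Compactness: a function that takes values in [l, u] arbitrarily close to
    0 has an accumulation point there.  The sequence that realizes it has to
    be decreasing, hence the recursive choice. *)
Lemma acc_points_exists (R : realType) (D : R -> R) (l u : R) : 0 < l ->
  (forall delta, 0 < delta ->
    exists2 t, 0 < t < delta & l <= D t <= u) ->
  exists2 y, acc_points D y & l <= y <= u.
Proof.
move=> l0 hD.
have inv0 n : 0 < n.+1%:R^-1 :> R by rewrite invr_gt0.
have /choice[s hs] n : exists t, 0 < t < n.+1%:R^-1 /\ l <= D t <= u.
  by have [t] := hD _ (inv0 n); exists t.
have [y yl hy] : exists2 y, l <= y <= u &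
    forall e delta, 0 < e -> 0 < delta ->
      exists t, 0 < t < delta /\ `|D t - y| < e.
  have sl : \forall n \near \oo, [set` `[l, u]] (D (s n)).
    by apply: nearW => n; rewrite /= in_itv /=; have [] := hs n.
  have [y [/= yl cy]] := @segment_compact R l u (D (s n) @[n --> \oo]) _ sl.
  exists y; first by move: yl; rewrite in_itv.
  move=> e delta e0 delta0.
  have hA : \forall n \near \oo,
      [set z | exists2 n, n.+1%:R^-1 < delta & z = D (s n)] (D (s n)).
    near=> n => /=; exists n => //; near: n.
    exact: near_infty_natSinv_lt (PosNum delta0).
  have hB : nbhs y [set z | `|z - y| < e].
    by apply/nbhs_ballP; exists e => //= z; rewrite -ball_normE /= distrC.
  have [_ [[n nd ->] zy]] := cy _ _ hA hB.
  exists (s n); split => //; have [/andP[-> h] _] := hs n.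
  exact: lt_trans h nd.
have /choice[nxt hnxt] (xn : R * nat) : exists t, 0 < xn.1 ->
    [/\ 0 < t, t < xn.1, t < xn.2.+1%:R^-1 & `|D t - y| < xn.2.+1%:R^-1].
  case: xn => x n /=; have [x0|] := ltP 0 x; last by exists 0 => x0; lra.
  have m0 : 0 < Num.min x n.+1%:R^-1 by rewrite lt_min x0 inv0.
  have [t [/andP[t0 +] ty]] := hy _ _ (inv0 n) m0.
  by rewrite lt_min => /andP[tx tn]; exists t.
pose v := fix v n := if n is n'.+1 then nxt (v n', n) else nxt (1, 0).
have v0 n : 0 < v n.
  elim: n => [|n IH] /=; first by have [] := hnxt (1, 0%N) ltr01.
  by have [] := hnxt (v n, n.+1) IH.
have vP n : v n < n.+1%:R^-1 /\ `|D (v n) - y| < n.+1%:R^-1.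
  by case: n => [|n] /=; [have [] := hnxt (1, 0%N) ltr01|
     have [] := hnxt (v n, n.+1) (v0 n)].
have y0 : 0 < y by have /andP[h _] := yl; exact: lt_le_trans h.
exists y => //; split => //; exists v; split => //.
- by apply/decreasing_seqP => n /=; have [] := hnxt (v n, n.+1) (v0 n).
- apply/cvgrPdist_lt => e e0; near=> n; rewrite sub0r normrN gtr0_norm //.
  apply: lt_trans (vP n).1 _; near: n.
  exact: near_infty_natSinv_lt (PosNum e0).
- apply/cvgrPdist_lt => e e0; near=> n; rewrite distrC.
  apply: lt_trans (vP n).2 _; near: n.
  exact: near_infty_natSinv_lt (PosNum e0).
Unshelve. all: by end_near. Qed.

Section Spectrum.
Context (R : realType) (d N : nat).
Context (S : 'I_N -> 'rV[R]_d -> 'rV[R]_d) (r p : 'I_N -> R).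
Context (K : set 'rV[R]_d) (mu : probability (borel_rV R d) R).
Context (beta : R -> R).
Hypothesis H : osc_system S r p K mu.
Hypothesis betaE : forall q : R, \sum_(i < N) (p i `^ q * r i `^ beta q) = 1.
Implicit Types (v w x : seq 'I_N) (y z : 'rV[R]_d).

Let r01 := ratio01 H.
Let p01 := weight01 H.
Let r_gt0 := ratio_gt0 H.
Let rho_gt0 := wratio_gt0 H.
Let pw_gt0 := wweight_gt0 H.

Lemma wprod_gibbs q w :
  wprod (gibbs r p beta q) w = wprod p w `^ q * wprod r w `^ beta q.
Proof.
elim: w => [|i w IH]; first by rewrite !wprod_nil !powR1 mulr1.
rewrite !wprod_cons IH gibbsE // !powRM ?(ltW (pw_gt0 w)) ?(ltW (rho_gt0 w)) //.
- by ring.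
- by rewrite ltW.
- by have /andP[/ltW] := p01 i.
Qed.

Lemma ball_mass_gt0 y (rho : R) : K y -> 0 < rho ->
  0 < mass mu (closed_eball y rho).
Proof.
move=> Ky rho0; have [c c0 hc] := mass_ball_lower H.
have [w sw wy] := attractor_cut H rho0 Ky.
apply: lt_le_trans (hc w y rho wy (stop_le r01 sw)).
by rewrite mulr_gt0.
Qed.

Lemma sum_const_seq (T : Type) (s : seq T) (k : R) :
  \sum_(v <- s) k = (size s)%:R * k.
Proof. by rewrite big_const_seq count_predT iter_addr_0 mulr_natl. Qed.

(** If the point sets at each small scale [rho] are close to cylinders that
    satisfy [p_v ^ q >= c * rho ^ tau], then such cylinders are at most about
    [rho ^ (- tau - beta q)] in number, as the [p_v ^ q * r_v ^ beta q] sum up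
    to 1. *)
Lemma cylinder_cover (Q : set 'rV[R]_d) q (c tau rho0 t : R) :
  0 < c -> 0 < rho0 -> 0 < t -> tau + beta q < t ->
  (forall rho y, 0 < rho -> rho < rho0 -> Q y -> exists v, [/\ stop r rho v,
     c * rho `^ tau <= wprod p v `^ q &
     exists2 z, cyl S K v z & enorm (y - z) <= rho]) ->
  forall delta eta : R, 0 < delta -> 0 < eta ->
    exists s : seq (set 'rV[R]_d), [/\
      forall y, Q y -> exists2 A, A \in s & A y,
      forall A, A \in s -> (diam A <= delta%:E)%E &
      (\sum_(A <- s) diam_pow t A <= eta%:E)%E].
Proof.
move=> c0 rho00 t0 tq hQ delta eta delta0 eta0.
have [D D0 KD] := cyl_diam H; have D2 : 0 < D + 2 by lra.
have [c' [c'0 c'1 c'r]] := fin_inf_gt0 r_gt0.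
have [c2 c20 hc2] : exists2 c2 : R, 0 < c2 & forall (rho : R) v, 0 < rho ->
    rho <= 1 -> stop r rho v -> c2 * rho `^ beta q <= wprod r v `^ beta q.
  have [b0|b0] := leP 0 (beta q).
    exists (c' `^ beta q); first by rewrite powR_gt0.
    move=> rho v rho_0 rho1 sv; rewrite -powRM ?(ltW c'0) ?(ltW rho_0) //.
    rewrite ge0_ler_powR ?nnegrE ?mulr_ge0 ?(ltW c'0) ?(ltW rho_0) ?(ltW (rho_gt0 v)) //.
    exact: (stop_ge r01).
  exists 1 => // rho v rho_0 rho1 sv; rewrite mul1r.
  rewrite /powR !gt_eqF // ler_expR ler_wnM2l ?(ltW b0) //.
  by rewrite ler_ln ?posrE // (stop_le r01).
have g0 : 0 < t - tau - beta q by lra.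
have k0 : 0 < (D + 2) `^ t / (c * c2) by rewrite divr_gt0 ?powR_gt0 ?mulr_gt0.
have [rho1 rho10 hrho1] := powR_small g0 k0 eta0.
pose rho := Num.min (Num.min (rho0 / 2) 1) (Num.min (delta / (D + 2)) rho1).
have rho_0 : 0 < rho by rewrite !lt_min ?divr_gt0 //= ltr01.
have rhoA : rho < rho0.
  by apply: le_lt_trans (_ : _ <= rho0 / 2) _; rewrite /rho ?ge_min ?lexx //; lra.
have rhoB : rho <= 1 by rewrite /rho !ge_min lexx !orbT.
have rhoC : (D + 2) * rho <= delta.
  by rewrite mulrC -ler_pdivlMr // /rho !ge_min lexx !orbT.
have rhoD : rho <= rho1 by rewrite /rho !ge_min lexx !orbT.
pose P v := c * rho `^ tau <= wprod p v `^ q.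
pose V v := [set y | exists2 z, cyl S K v z & enorm (y - z) <= rho].
have V_diam v : stop r rho v -> (diam (V v) <= ((D + 2) * rho)%:E)%E.
  move=> sv; apply: diam_le => y1 y2 [z1 vz1 yz1] [z2 vz2 yz2].
  have := KD _ _ _ vz1 vz2; have := enorm_triangle y1 z1 y2.
  have := enorm_triangle z1 z2 y2; rewrite (enormC z2 y2).
  have := stop_le r01 sv; nra.
pose s := [seq v <- cut r rho | P v].
exists [seq V v | v <- s]; split.
- move=> y Qy; have [v [sv Pv vy]] := hQ rho y rho_0 rhoA Qy.
  by exists (V v) => //; apply: map_f; rewrite mem_filter mem_cut // sv andbT.
- move=> _ /mapP[v + ->]; rewrite mem_filter mem_cut // => /andP[_ sv].
  by apply: le_trans (V_diam v sv) _; rewrite lee_fin.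
have szs : (size s)%:R * (c * rho `^ tau * (c2 * rho `^ beta q)) <= 1.
  rewrite -[leRHS](sum_cut_wprod r01 rho_0 (gibbs_sum r01 p01 betaE q)).
  apply: (@le_trans _ _ (\sum_(v <- s) wprod (gibbs r p beta q) v)).
    rewrite -sum_const_seq big_seq [leRHS]big_seq; apply: ler_sum => v.
    rewrite mem_filter mem_cut // => /andP[Pv sv]; rewrite wprod_gibbs.
    apply: ler_pM; [| |exact: Pv|exact: hc2]; apply: mulr_ge0;
      by rewrite ?powR_ge0 // ltW.
  rewrite big_filter [leRHS](bigID P) /= lerDl sumr_ge0 // => v _.
  by rewrite wprod_gibbs mulr_ge0 ?powR_ge0.
rewrite big_map big_seq.
apply: (@le_trans _ _ (\sum_(v <- s | v \in s) (((D + 2) * rho) `^ t)%:E)%E).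
  apply: lee_sum => v; rewrite mem_filter mem_cut // => /andP[_ sv].
  by apply: diam_pow_le (V_diam v sv); rewrite ?mulr_ge0 // ltW.
rewrite -big_seq sumEFin lee_fin sum_const_seq.
apply: le_trans (hrho1 rho (ltW rho_0) rhoD).
have -> : ((D + 2) * rho) `^ t =
    (D + 2) `^ t * rho `^ (t - tau - beta q) * (rho `^ tau * rho `^ beta q).
  rewrite powRM ?(ltW D2) ?(ltW rho_0) // -mulrA; congr (_ * _).
  rewrite -!powRD ?(gt_eqF rho_0) ?implybT //.
  by congr (_ `^ _); ring.
have cc : 0 < c * c2 by rewrite mulr_gt0.
rewrite [leRHS]mulrAC ler_pdivlMr //.
set X := (D + 2) `^ t * rho `^ (t - tau - beta q).
have X0 : 0 <= X by rewrite mulr_ge0 ?powR_ge0.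
rewrite -[leRHS]mulr1; apply: le_trans (ler_wpM2l X0 szs).
by rewrite le_eqVlt; apply/orP; left; apply/eqP; ring.
Qed.

End Spectrum.
Section UpperBound.
Context (R : realType) (d N : nat).
Context (S : 'I_N -> 'rV[R]_d -> 'rV[R]_d) (r p : 'I_N -> R).
Context (K : set 'rV[R]_d) (mu : probability (borel_rV R d) R).
Context (beta : R -> R) (i0 i1 : 'I_N).
Hypothesis H : osc_system S r p K mu.
Hypothesis betaE : forall q : R, \sum_(i < N) (p i `^ q * r i `^ beta q) = 1.
Hypothesis ext : forall i, exponent r p i0 <= exponent r p i <= exponent r p i1.
Implicit Types (v w x : seq 'I_N) (y z : 'rV[R]_d).

Let r01 := ratio01 H.
Let p01 := weight01 H.
Let r_gt0 := ratio_gt0 H.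
Let rho_gt0 := wratio_gt0 H.
Let pw_gt0 := wweight_gt0 H.
Let A := exponent r p i0.
Let B := exponent r p i1.

Lemma ln_weight_bounds w :
  B * ln (wprod r w) <= ln (wprod p w) <= A * ln (wprod r w).
Proof.
rewrite !ln_wprod //; last exact: weight_gt0 H.
rewrite !mulr_sumr; apply/andP; split; apply: ler_sum => i _;
  rewrite (exponentE p r01) ler_nM2r ?(ln_ratio_lt0 r01) //;
  by have /andP[] := ext i.
Qed.

Lemma ball_exponent_bounds : exists l u delta : R,
  [/\ 0 < l, 0 < delta, delta < 1 & forall y rho, K y -> 0 < rho -> rho < delta ->
    l <= ball_exponent mu y rho <= u].
Proof.
have [c c0 hc] := mass_ball_lower H; have [M M1 hM] := mass_ball_upper H.
have [c' [c'0 c'1 c'r]] := fin_inf_gt0 r_gt0.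
have A0 : 0 < A by exact: exponent_gt0 r01 p01 i0.
have B0 : 0 < B by exact: exponent_gt0 r01 p01 i1.
pose k := Num.min (ln c + B * ln c') (- (2 * ln M / A)).
exists (A / 2), (B + 1), (Num.min 2^-1 (expR k)); split.
- by rewrite divr_gt0.
- by rewrite lt_min expR_gt0 invr_gt0 ltr0n.
- by rewrite gt_min; apply/orP; left; lra.
move=> y rho Ky rho0; rewrite lt_min => /andP[rho1 rhok].
have lrho : ln rho < k by rewrite -ltr_expR lnK.
have lr0 : ln rho < 0 by rewrite ln_lt0 // rho0 /=; lra.
have m0 := ball_mass_gt0 H Ky rho0.
rewrite /ball_exponent -/(mass mu _); apply/andP; split.
  have le : mass mu (closed_eball y rho) <= M * rho `^ A.
    apply: hM => //; [lra|exact: powR_ge0|] => v z sv _ _.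
    rewrite -ler_ln ?posrE ?powR_gt0 // ln_powR.
    have /andP[_ h] := ln_weight_bounds v; apply: le_trans h _.
    by rewrite ler_wpM2l ?(ltW A0) // ler_ln ?posrE // (stop_le r01).
  have M0 : 0 < M by lra.
  rewrite ler_ndivlMr //; move: le.
  rewrite -ler_ln ?posrE ?mulr_gt0 ?powR_gt0 // lnM ?posrE ?powR_gt0 // ln_powR.
  have : ln rho <= - (2 * ln M / A).
    by apply: le_trans (ltW lrho) _; rewrite ge_min lexx orbT.
  rewrite -mulNr ler_pdivlMr //; lra.
have [w sw wy] := attractor_cut H rho0 Ky.
have h1 := hc w y rho wy (stop_le r01 sw).
have rho1' : rho <= 1 by lra.
have h2 := stop_ge r01 c'1 c'r rho1' rho0 sw.
rewrite ler_ndivrMr //.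
rewrite -ler_ln ?posrE ?mulr_gt0 // lnM ?posrE // in h1.
rewrite -ler_ln ?posrE ?mulr_gt0 // lnM ?posrE // in h2.
have /andP[h3 _] := ln_weight_bounds w.
have h4 : B * (ln c' + ln rho) <= B * ln (wprod r w) by rewrite ler_wpM2l // ltW.
have : ln rho <= ln c + B * ln c'.
  by apply: le_trans (ltW lrho) _; rewrite ge_min lexx.
by move: h1 h3 h4; rewrite mulrDr mulrDl mul1r; lra.
Qed.

Definition level_set (I : set R) : set 'rV[R]_d :=
  [set y | K y /\ acc_points (ball_exponent mu y) `<=` I].

(** Accumulation points in [a, b] bound the exponent of small balls by
    [b + e] from above and by [a - e] from below.  For [q >= 0] the former
    forces a cylinder of large weight near each point, for [q < 0] the latter
    forces cylinders of small weight; either way [p_v ^ q] is large. *)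
Lemma hausdorff_measure_level_set (I : set R) a b q t :
  (forall al, I al -> a <= al <= b) -> 0 < b ->
  0 < t -> Num.max (a * q) (b * q) + beta q < t ->
  hausdorff_measure t (level_set I) = 0%E.
Proof.
move=> Iab b0 t0 tq.
have [l [u [del [l0 del0 del1 hD]]]] := ball_exponent_bounds.
pose e := (t - (Num.max (a * q) (b * q) + beta q)) / (2 * (`|q| + 1)).
have q1 : 0 < `|q| + 1 by rewrite ltr_wpDl.
have e0 : 0 < e by rewrite divr_gt0 ?mulr_gt0 ?subr_gt0.
have eq : e * `|q| < t - (Num.max (a * q) (b * q) + beta q).
  rewrite /e mulrAC ltr_pdivrMr ?mulr_gt0 // ltr_pM2l ?subr_gt0 //.
  by have := normr_ge0 q; lra.
have inv0 n : 0 < n.+1%:R^-1 :> R by rewrite invr_gt0.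
pose rho0 n : R := Num.min n.+1%:R^-1 del.
have rho00 n : 0 < rho0 n by rewrite lt_min inv0.
have rho0n n rho : rho < rho0 n -> rho < n.+1%:R^-1 /\ rho < del.
  by rewrite lt_min => /andP[].
(* Bad scales arbitrarily close to 0 would accumulate at a value outside I. *)
have evt (P : R -> bool) (l' u' : R) : 0 < l' ->
    (forall y rho, K y -> 0 < rho -> rho < del ->
      ~~ P (ball_exponent mu y rho) -> l' <= ball_exponent mu y rho <= u') ->
    (forall al, l' <= al <= u' -> ~ I al) ->
    level_set I `<=` \bigcup_n [set y | K y /\ forall rho, 0 < rho ->
      rho < rho0 n -> P (ball_exponent mu y rho)].
  move=> l'0 hP hI y [Ky accI]; apply: contrapT => nF.
  have [|z zacc zlu] := @acc_points_exists R (ball_exponent mu y) l' u' l'0.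
    move=> dl dl0; have m0 : 0 < Num.min dl del by rewrite lt_min dl0.
    have [n _ nd] : \forall n \near \oo, n.+1%:R^-1 < Num.min dl del :> R.
      exact: near_infty_natSinv_lt (PosNum m0).
    have {}nd := nd n (leqnn n); apply: contrapT => nex; apply: nF.
    exists n => //; split => // rho rho_0 rho_n; apply: contrapT => /negP nP.
    have [rn rd] := rho0n _ _ rho_n; apply: nex; exists rho.
      by rewrite rho_0 /=; move: nd; rewrite lt_min => /andP[nd _]; exact: lt_trans nd.
    exact: hP.
  by apply: (hI z) => //; exact: accI.
have [q0|q0] := leP 0 q.
  have max_b : b * q <= Num.max (a * q) (b * q) by rewrite le_max lexx orbT.
  have [M M1 hM] := mass_ball_upper H; have M0 : 0 < M by lra.
  pose P D := D <= b + e.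
  have /hausdorff_measure_bigcup0 : level_set I `<=` \bigcup_n [set y | K y /\
      forall rho, 0 < rho -> rho < rho0 n -> P (ball_exponent mu y rho)].
    apply: (evt _ (b + e) u); first by lra.
      move=> y rho Ky rho_0 rhod; rewrite -ltNge => /ltW ->.
      by have /andP[] := hD y rho Ky rho_0 rhod.
    by move=> al /andP[h _] /Iab/andP[_]; lra.
  apply => n; apply: (cylinder_cover H betaE (c := ((2 * M)^-1) `^ q)
      (tau := (b + e) * q) _ (rho00 n) t0); first by apply: powR_gt0; rewrite invr_gt0; lra.
    by move: eq; rewrite ger0_norm // mulrDl; lra.
  move=> rho y rho_0 /[dup] rho_n /rho0n[_ rho_d] [Ky hP].
  have lr0 : ln rho < 0 by rewrite ln_lt0 // rho_0 /=; lra.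
  have m0 := ball_mass_gt0 H Ky rho_0.
  have hm : rho `^ (b + e) <= mass mu (closed_eball y rho).
    rewrite -ler_ln ?posrE ?powR_gt0 // ln_powR.
    by have := hP rho rho_0 rho_n; rewrite /P /ball_exponent ler_ndivrMr.
  pose s := (2 * M)^-1 * rho `^ (b + e).
  have s0 : 0 < s by rewrite mulr_gt0 ?powR_gt0 // invr_gt0; lra.
  have [v [sv sp vy]] : exists v, [/\ stop r rho v, s <= wprod p v &
      exists2 z, cyl S K v z & enorm (z - y) <= rho].
    apply: contrapT => nex.
    have : mass mu (closed_eball y rho) <= M * s.
      apply: hM => //; [lra|exact: ltW|] => v z sv vz zy.
      rewrite leNgt; apply/negP => sp; apply: nex; exists v.
      by split; [|exact: ltW|exists z].
    apply/negP; rewrite -ltNge; apply: lt_le_trans hm.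
    have -> : M * s = 2^-1 * rho `^ (b + e) by rewrite /s; field; rewrite gt_eqF.
    by rewrite gtr_pMl ?powR_gt0 //; lra.
  exists v; split=> //.
    rewrite powRrM -powRM ?powR_ge0 ?invr_ge0 //; last lra.
    by rewrite ge0_ler_powR ?nnegrE ?(ltW s0) ?(ltW (pw_gt0 v)).
  by case: vy => z vz zy; exists z => //; rewrite enormC.
have max_a : a * q <= Num.max (a * q) (b * q) by rewrite le_max lexx.
have [c c0 hc] := mass_ball_lower H.
pose P D := a - e <= D.
have /hausdorff_measure_bigcup0 : level_set I `<=` \bigcup_n [set y | K y /\
    forall rho, 0 < rho -> rho < rho0 n -> P (ball_exponent mu y rho)].
  apply: (evt _ l (a - e)) => //.
    move=> y rho Ky rho_0 rhod; rewrite -ltNge => /ltW ->.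
    by have /andP[->] := hD y rho Ky rho_0 rhod.
  by move=> al /andP[_ h] /Iab/andP[+ _]; lra.
apply => n; apply: (cylinder_cover H betaE (c := (c^-1) `^ q)
    (tau := (a - e) * q) _ (rho00 n) t0); first by apply: powR_gt0; rewrite invr_gt0.
  by move: eq; rewrite ltr0_norm // mulrBl; lra.
move=> rho y rho_0 /[dup] rho_n /rho0n[_ rho_d] [Ky hP].
have lr0 : ln rho < 0 by rewrite ln_lt0 // rho_0 /=; lra.
have m0 := ball_mass_gt0 H Ky rho_0.
have hm : mass mu (closed_eball y rho) <= rho `^ (a - e).
  rewrite -ler_ln ?posrE ?powR_gt0 // ln_powR.
  by have := hP rho rho_0 rho_n; rewrite /P /ball_exponent ler_ndivlMr.
have [v sv vy] := attractor_cut H rho_0 Ky.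
exists v; split=> //; last by exists y; rewrite ?subrr ?enorm0 ?ltW.
rewrite powRrM -powRM ?powR_ge0 ?invr_ge0 ?(ltW c0) //.
have := le_trans (hc v y rho vy (stop_le r01 sv)) hm.
rewrite -ler_pdivlMl // => h.
rewrite /powR !gt_eqF ?mulr_gt0 ?invr_gt0 ?expR_gt0 // ler_expR.
rewrite ler_nM2l // ler_ln ?posrE ?mulr_gt0 ?invr_gt0 ?expR_gt0 //.
by move: h; rewrite /powR gt_eqF.
Qed.

End UpperBound.
(** * The lower bound: paths in a tree and blocks of letters *)

Section TreePaths.
Context (R : realType) (T : eqType) (A : nat -> seq T) (W : nat -> T -> R).
Hypotheses (A_uniq : forall j, uniq (A j)) (W_ge0 : forall j g, 0 <= W j g).
Hypothesis W_sum : forall j, \sum_(g <- A j) W j g = 1.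

Fixpoint path_weight j (z : seq T) : R :=
  if z is g :: z' then W j g * path_weight j.+1 z' else 1.

(** The conditional mass of the paths through [z] among those through [x]. *)
Fixpoint cond_weight j (x z : seq T) : R :=
  match x, z with
  | [::], _ => path_weight j z
  | _ :: _, [::] => 1
  | g :: x', h :: z' => if g == h then cond_weight j.+1 x' z' else 0
  end.

Lemma path_weight_ge0 j z : 0 <= path_weight j z.
Proof. by elim: z j => //= g z IH j; rewrite mulr_ge0. Qed.

Lemma cond_weight_ge0 j x z : 0 <= cond_weight j x z.
Proof.
elim: x j z => [|g x IH] j [|h z] //=; first by rewrite mulr_ge0 ?path_weight_ge0.
by case: ifP.
Qed.

Lemma cond_weight_prefix j x z : prefix z x -> cond_weight j x z = 1.
Proof.
elim: x j z => [|g x IH] j [|h z] //= /andP[/eqP -> zx].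
by rewrite eqxx IH.
Qed.

Lemma cond_weight_step j x z :
  \sum_(g <- A (j + size x)%N) W (j + size x) g * cond_weight j (rcons x g) z
  <= cond_weight j x z.
Proof.
elim: x j z => [|g x IH] j [|h z] /=.
- by rewrite addn0; under eq_bigr do rewrite mulr1; rewrite W_sum.
- rewrite addn0; have [hA|hA] := boolP (h \in A j).
    rewrite (bigD1_seq h) //= eqxx big1 ?addr0 // => g /negPf ->.
    by rewrite mulr0.
  rewrite big_seq big1 => [|g gA]; first by rewrite mulr_ge0 ?path_weight_ge0.
  by case: eqP => [gh|_]; [rewrite gh (negPf hA) in gA|rewrite mulr0].
- by under eq_bigr do rewrite mulr1; rewrite W_sum.
- rewrite addnS -addSn; case: eqP => [_|_]; first exact: IH.
  by rewrite big1 // => k _; rewrite mulr0.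
Qed.

(** A mass distribution principle without measures: as long as the conditional
    masses of the prefixes [z n] add up to less than 1, some letter keeps it
    so, since the sum is at least its average over the next letter. *)
Lemma path_avoiding (z : nat -> seq T) :
  (\sum_(0 <= n <oo) (path_weight 0 (z n))%:E < 1)%E ->
  exists om : nat -> T, (forall j, om j \in A j /\ 0 < W j (om j)) /\
    forall n, mkseq om (size (z n)) <> z n.
Proof.
move=> z1; pose M x : \bar R := (\sum_(0 <= n <oo) (cond_weight 0 x (z n))%:E)%E.
have step x : exists g, (M x < 1)%E -> [/\ g \in A (size x), 0 < W (size x) g &
    (M (rcons x g) < 1)%E].
  have [Mx|Mx] := boolP (M x < 1)%E; last first.
    have [g _] : exists g, g \in A 0.
      case E : (A 0) => [|g s]; last by exists g; rewrite mem_head.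
      by have := W_sum 0; rewrite E big_nil => /esym/eqP; rewrite oner_eq0.
    by exists g.
  apply: contrapT => ng.
  have {}ng g : g \in A (size x) -> 0 < W (size x) g -> (1 <= M (rcons x g))%E.
    by move=> gA Wg; rewrite leNgt; apply/negP => Mg; apply: ng; exists g.
  move: Mx; apply/negP; rewrite -leNgt.
  apply: (@le_trans _ _ (\sum_(g <- A (size x)) (W (size x) g)%:E * M (rcons x g))%E).
    rewrite -(W_sum (size x)) -sumEFin big_seq [leRHS]big_seq.
    apply: lee_sum => g gA; have := W_ge0 (size x) g; rewrite le_eqVlt.
    case/predU1P => [<-|Wg]; first by rewrite mul0e.
    by rewrite -[leLHS]mule1 lee_pmul2l // ng.
  have c0 g n : (0 <= (cond_weight 0 (rcons x g) (z n))%:E)%E.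
    by rewrite lee_fin cond_weight_ge0.
  rewrite (eq_bigr (fun g => \sum_(0 <= n <oo)
      (W (size x) g)%:E * (cond_weight 0 (rcons x g) (z n))%:E)%E); last first.
    by move=> g _; rewrite nneseriesZl.
  rewrite -nneseries_sum; last by move=> g n _; rewrite mule_ge0 // lee_fin.
  apply: lee_nneseries => [n _ _|n _].
    by apply: sume_ge0 => g _; rewrite mule_ge0 // lee_fin.
  under eq_bigr do rewrite -EFinM.
  by rewrite sumEFin lee_fin; exact: (cond_weight_step 0 x (z n)).
have [nxt hnxt] := choice step.
pose X := fix X k := if k is k'.+1 then rcons (X k') (nxt (X k')) else [::].
have Xs k : size (X k) = k by elim: k => //= k IH; rewrite size_rcons IH.
have MX k : (M (X k) < 1)%E.
  by elim: k => [|k IH] //=; have [] := hnxt _ IH.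
pose om k := nxt (X k).
have XE k : X k = mkseq om k.
  by elim: k => //= k IH; rewrite mkseqS -IH.
exists om; split=> [j|n e].
  by have [] := hnxt _ (MX j); rewrite Xs.
have := MX (size (z n)); apply/negP; rewrite -leNgt.
rewrite (_ : 1%E = (cond_weight 0 (X (size (z n))) (z n))%:E); last first.
  by rewrite cond_weight_prefix // XE e prefix_refl.
rewrite /M; set f := fun m => _.
apply: le_trans (nneseries_lim_ge n.+1 _) => [|m _ _]; last first.
  by rewrite lee_fin cond_weight_ge0.
rewrite big_nat_recr //= leeDr // sume_ge0 // => m _.
by rewrite lee_fin cond_weight_ge0.
Qed.

End TreePaths.

Section Blocks.
Context (R : realType) (N : nat) (r p : 'I_N -> R) (beta : R -> R) (i0 i1 : 'I_N).
Hypotheses (r01 : forall i, 0 < r i < 1) (p01 : forall i, 0 < p i < 1).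
Hypothesis betaE : forall q : R, \sum_(i < N) (p i `^ q * r i `^ beta q) = 1.
Hypothesis ext : forall i, exponent r p i0 <= exponent r p i <= exponent r p i1.
Implicit Types (g w u : seq 'I_N).

Let r_gt0 i : 0 < r i. Proof. by have /andP[] := r01 i. Qed.
Let p_gt0 i : 0 < p i. Proof. by have /andP[] := p01 i. Qed.

Fixpoint words n : seq (seq 'I_N) :=
  if n is n'.+1 then flatten [seq [seq i :: w | w <- words n'] | i <- enum 'I_N]
  else [:: [::]].

Lemma words_uniq n : uniq (words n).
Proof.
elim: n => //= n IH; apply: allpairs_uniq_dep => [|i _|] //.
  exact: enum_uniq.
by move=> [i v] [j w] _ _ /= [-> ->].
Qed.

Lemma size_words n w : w \in words n -> size w = n.
Proof.
elim: n w => [|n IH] w /=; first by rewrite inE => /eqP ->.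
by case/flatten_mapP=> i _ /mapP[v /IH <- ->].
Qed.

Lemma sum_words (f : 'I_N -> R) n :
  \sum_(w <- words n) wprod f w = (\sum_i f i) ^+ n.
Proof.
elim: n => [|n IH] /=; first by rewrite big_seq1 wprod_nil expr0.
rewrite big_flatten big_map big_enum /= exprS mulr_suml.
apply: eq_bigr => i _; rewrite big_map -IH mulr_sumr.
by apply: eq_bigr => w _; rewrite wprod_cons.
Qed.

(** Markov's inequality for the exponential of an additive function. *)
Lemma chernoff (P x : 'I_N -> R) (t : R) n : (forall i, 0 <= P i) -> 0 < t ->
  \sum_(w <- words n | 0 <= \sum_(i <- w) x i) wprod P w
  <= (\sum_i P i * expR (t * x i)) ^+ n.
Proof.
move=> P0 t0; rewrite -sum_words [leRHS](bigID (fun w => 0 <= \sum_(i <- w) x i)) /=.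
have wP0 w : 0 <= wprod P w by apply: prodr_ge0.
have wE w : wprod (fun i => P i * expR (t * x i)) w =
    wprod P w * expR (t * \sum_(i <- w) x i).
  elim: w => [|i w IH]; first by rewrite !wprod_nil big_nil mulr0 expR0 mulr1.
  by rewrite !wprod_cons IH big_cons mulrDr expRD; ring.
rewrite -[leLHS]addr0 lerD //; last first.
  by apply: sumr_ge0 => w _; rewrite wE mulr_ge0 ?expR_ge0.
apply: ler_sum => w xw; rewrite wE ler_peMr // -[leLHS]expR0 ler_expR.
by rewrite mulr_ge0 // ltW.
Qed.

Lemma ln_wratio_linear : exists2 k : R, 0 < k &
  forall w, k * (size w)%:R <= - ln (wprod r w).
Proof.
have [c [c0 c1 rc]] := fin_sup_lt1 r01; exists (- ln c).
  by rewrite oppr_gt0 ln_lt0 // c0.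
move=> w; rewrite mulNr lerN2 mulr_natr -lnXn // ler_ln ?posrE ?exprn_gt0 ?wprod_gt0 //.
by apply: wprod_le_exp => i; rewrite r_gt0 rc.
Qed.

(** For the Gibbs vector of a minimizer of [al * q + beta q], long words have
    typically a local exponent close to [al], by the vanishing of the mean in
    [gibbs_mean]; the weight [p_w ^ q * r_w ^ beta q] of such a word is then
    about [r_w ^ (al * q + beta q)].  Conditioning on the typical words and
    appending a fixed suffix [u] change logarithms by bounded amounts only,
    which long words absorb. *)
Lemma block_exists al s e u : exponent r p i0 <= al -> al <= exponent r p i1 ->
  (forall q, s <= al * q + beta q) -> 0 < e ->
  exists (L : nat) (A : seq (seq 'I_N)) (W : seq 'I_N -> R),
    [/\ [/\ (0 < L)%N, uniq A & forall w, 0 <= W w], \sum_(w <- A) W w = 1,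
        forall w, w \in A -> size w = L /\ exists g, w = g ++ u &
        forall w, w \in A -> 0 < W w ->
          `|ln (wprod p w) - al * ln (wprod r w)| <= e * - ln (wprod r w) /\
          ln (W w) <= (s - e) * ln (wprod r w)].
Proof.
move=> al0 al1 hs e0; have e4 : 0 < e / 4 by rewrite divr_gt0.
have [al' [q [ale hmin smin]]] :=
  legendre_minimizer r01 p01 betaE ext al0 al1 hs e4.
have P0 i : 0 <= gibbs r p beta q i by rewrite ltW ?gibbs_gt0.
have P1 := gibbs_sum r01 p01 betaE q.
have mean := gibbs_mean r01 p01 betaE hmin.
set P := gibbs r p beta q in P0 P1 mean.
pose e1 := e / 4 / (`|q| + 1); have q1 : 0 < `|q| + 1 by rewrite ltr_wpDl.
have e10 : 0 < e1 by rewrite divr_gt0.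
have e1q : e1 * `|q| + e1 = e / 4 by rewrite /e1; field; rewrite gt_eqF.
have e1q0 : 0 <= e1 * `|q| by rewrite mulr_ge0 // ltW.
pose c i := ln (p i) - al' * ln (r i).
pose x1 i := c i + e1 * ln (r i); pose x2 i := - c i + e1 * ln (r i).
have ch0 : \sum_i P i * ln (r i) < 0.
  rewrite -oppr_gt0 -sumrN (bigD1 i0) //= ltr_pwDl //.
    by rewrite oppr_gt0 pmulr_rlt0 ?gibbs_gt0 // ln_ratio_lt0.
  apply: sumr_ge0 => i _; rewrite oppr_ge0 pmulr_rle0 ?gibbs_gt0 //.
  by rewrite ltW // ln_ratio_lt0.
have m1 : \sum_i P i * x1 i < 0.
  rewrite (eq_bigr (fun i => P i * c i + e1 * (P i * ln (r i)))).
    by rewrite big_split /= mean add0r -mulr_sumr pmulr_rlt0.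
  by move=> i _; rewrite /x1; ring.
have m2 : \sum_i P i * x2 i < 0.
  rewrite (eq_bigr (fun i => - (P i * c i) + e1 * (P i * ln (r i)))).
    by rewrite big_split /= sumrN mean oppr0 add0r -mulr_sumr pmulr_rlt0.
  by move=> i _; rewrite /x2; ring.
have [t1 t10 th1] := exp_moment_lt1 P0 P1 m1.
have [t2 t20 th2] := exp_moment_lt1 P0 P1 m2.
pose f1 := \sum_i P i * expR (t1 * x1 i).
pose f2 := \sum_i P i * expR (t2 * x2 i).
have pos t (x : 'I_N -> R) : 0 < \sum_i P i * expR (t * x i).
  rewrite (bigD1 i0) // ltr_pwDl //; last first.
    by apply: sumr_ge0 => i _; rewrite mulr_ge0 ?expR_ge0.
  by apply: mulr_gt0; [exact: gibbs_gt0|exact: expR_gt0].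
have q4 : 0 < 4^-1 :> R by rewrite invr_gt0.
have [n1 hn1] := expr_small (pos t1 x1) th1 q4.
have [n2 hn2] := expr_small (pos t2 x2) th2 q4.
have [k k0 hk] := ln_wratio_linear.
set Ru := - ln (wprod r u).
have Ru0 : 0 <= Ru by rewrite oppr_ge0 ln_le0 // wprod_le1.
pose Cu := `|ln (wprod p u) - al * ln (wprod r u)|.
have ln20 : 0 <= ln 2 :> R by rewrite ln_ge0 // ler1n.
have sR0 : 0 <= `|s - e| * Ru by rewrite mulr_ge0.
have Cu0 : 0 <= Cu by exact: normr_ge0.
pose X := (Cu + ln 2 + `|s - e| * Ru) / (e / 2 * k).
have [n [nn1 nn2 n0 nX]] : exists n : nat, [/\ (n1 <= n)%N, (n2 <= n)%N, (0 < n)%N &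
    Cu + ln 2 + `|s - e| * Ru <= e / 2 * (k * n%:R)].
  exists (maxn (maxn n1 n2) (Num.bound X).+1).
  split; first by rewrite leq_max leq_maxl.
  - by rewrite leq_max leq_maxr.
  - by rewrite leq_max orbT.
  have ek : 0 < e / 2 * k by rewrite mulr_gt0 ?divr_gt0.
  rewrite mulrA -ler_pdivrMl // mulrC -/X.
  apply: le_trans (ltW (archi_boundP _)) _.
    by rewrite /X divr_ge0 ?(ltW ek) // !addr_ge0.
  by rewrite ler_nat leq_max leqnSn orbT.
have small f m : 0 < f -> f < 1 -> f ^+ m < 4^-1 -> (m <= n)%N -> f ^+ n < 4^-1.
  move=> f0 f1' fm mn; apply: le_lt_trans fm.
  by rewrite ler_wiXn2l // ltW.
have {}hn1 : f1 ^+ n < 4^-1.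
  exact: small hn1 nn1.
have {}hn2 : f2 ^+ n < 4^-1.
  exact: small hn2 nn2.
pose cw g := ln (wprod p g) - al' * ln (wprod r g).
have cwE g : cw g = \sum_(i <- g) c i.
  rewrite /cw !ln_wprod // mulr_sumr -sumrN -big_split /=.
  by apply: eq_bigr.
have x1E g : \sum_(i <- g) x1 i = cw g + e1 * ln (wprod r g).
  by rewrite big_split /= -cwE -mulr_sumr ln_wprod.
have x2E g : \sum_(i <- g) x2 i = - cw g + e1 * ln (wprod r g).
  by rewrite big_split /= sumrN -cwE -mulr_sumr ln_wprod.
pose good g := (\sum_(i <- g) x1 i < 0) && (\sum_(i <- g) x2 i < 0).
pose Z := \sum_(g <- words n | good g) wprod P g.
have wP0 g : 0 <= wprod P g by apply: prodr_ge0.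
have Z2 : 2^-1 <= Z.
  have tot : \sum_(g <- words n) wprod P g = 1 by rewrite sum_words P1 expr1n.
  have h1 : _ <= f1 ^+ n := chernoff x1 n P0 t10.
  have h2 : _ <= f2 ^+ n := chernoff x2 n P0 t20.
  suff : \sum_(g <- words n) wprod P g <= Z +
      (\sum_(g <- words n | 0 <= \sum_(i <- g) x1 i) wprod P g +
       \sum_(g <- words n | 0 <= \sum_(i <- g) x2 i) wprod P g).
    by rewrite tot => h; lra.
  rewrite /Z [X in X + _]big_mkcond [X in _ + (X + _)]big_mkcond.
  rewrite [X in _ + (_ + X)]big_mkcond -!big_split /=.
  apply: ler_sum => g _; rewrite /good !ltNge; have := wP0 g.
  by move: (0 <= \sum_(i <- g) x1 i) (0 <= \sum_(i <- g) x2 i) => [] [] /=; lra.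
have Z0 : 0 < Z by apply: lt_le_trans Z2; rewrite invr_gt0.
pose W w := if good (take n w) then wprod P (take n w) / Z else 0.
have takeE g : g \in words n -> take n (g ++ u) = g.
  by move=> /size_words gn; rewrite take_size_cat.
exists (n + size u)%N, [seq g ++ u | g <- words n], W; split.
- split; last by move=> w; rewrite /W; case: ifP => // _; rewrite divr_ge0 // ltW.
    by rewrite addn_gt0 n0.
  rewrite map_inj_in_uniq ?words_uniq // => g h gn hn gh.
  by rewrite -(takeE g gn) gh takeE.
- rewrite big_map big_seq.
  rewrite (eq_bigr (fun g => if good g then wprod P g / Z else 0)).
    by rewrite -big_seq -big_mkcond /= -mulr_suml divff // gt_eqF.
  by move=> g gn; rewrite /W takeE.
- move=> _ /mapP[g gn ->]; rewrite size_cat (size_words gn); split => //.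
  by exists g.
move=> _ /mapP[g gn ->]; rewrite /W takeE //; case: ifP => [gd|]; last by rewrite ltxx.
move=> _; have : good g by []. 
rewrite /good x1E x2E => /andP[g1 g2].
have rg := hk g; rewrite (size_words gn) in rg.
rewrite !wprod_cat (@lnM _ (wprod p g)) ?(@lnM _ (wprod r g)) ?posrE ?wprod_gt0 //.
set lr := ln (wprod r g) in rg g1 g2 *; set lp := ln (wprod p g).
have cgE : cw g = lp - al' * lr by [].
have nX' : Cu + ln 2 + `|s - e| * Ru <= e / 2 * - lr.
  by apply: le_trans nX _; rewrite ler_wpM2l // divr_ge0 // ltW.
have lr0 : 0 <= - lr by apply: le_trans rg; rewrite mulr_ge0 // ltW.
have cg : `|cw g| <= e1 * - lr by rewrite ler_norml; lra.
have e1lr : 0 <= e1 * `|q| * - lr by rewrite mulr_ge0.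
have e1e : e1 * - lr + e1 * `|q| * - lr = e / 4 * - lr by rewrite -e1q; ring.
split.
  have -> : lp + ln (wprod p u) - al * (lr + ln (wprod r u)) =
    cw g + (al' - al) * lr + (ln (wprod p u) - al * ln (wprod r u)).
    by rewrite cgE; ring.
  apply: le_trans (ler_normD _ _) _; rewrite -/Cu.
  apply: le_trans (lerD (ler_normD _ _) (lexx _)) _.
  have : `|(al' - al) * lr| <= e / 4 * - lr.
    by rewrite normrM -(normrN lr) (ger0_norm lr0) ler_wpM2r.
  have : 0 <= e * Ru by rewrite mulr_ge0 // ltW.
  have : 0 <= e * - lr by rewrite mulr_ge0 // ltW.
  by rewrite /Ru in nX' sR0 *; lra.
rewrite lnM ?posrE ?invr_gt0 //; last by apply: prodr_gt0 => i _; exact: gibbs_gt0.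
rewrite lnV ?posrE //.
have lnZ : - ln Z <= ln 2 by rewrite lerNl -lnV ?posrE // ler_ln ?posrE ?invr_gt0.
have -> : ln (wprod P g) = (al' * q + beta q) * lr + q * cw g.
  rewrite ln_wprod; last by move=> i; exact: gibbs_gt0.
  transitivity (q * lp + beta q * lr); last by rewrite cgE; ring.
  rewrite /lp /lr !ln_wprod // !mulr_sumr -big_split /=.
  by apply: eq_bigr => i _; rewrite /P /gibbs expRK.
have h1 : (al' * q + beta q) * lr <= (s - e / 4) * lr by rewrite ler_wnM2r //; lra.
have h2 : q * cw g <= e1 * `|q| * - lr.
  apply: le_trans (ler_norm _) _; rewrite normrM mulrC mulrAC ler_wpM2r //.
have h3 : - (`|s - e| * Ru) <= (s - e) * ln (wprod r u).
  have -> : (s - e) * ln (wprod r u) = - ((s - e) * Ru) by rewrite /Ru; ring.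
  by rewrite lerN2 ler_wpM2r // ler_norm.
have e1lr0 : 0 <= e1 * - lr by rewrite mulr_ge0 // ltW.
by lra.
Qed.

End Blocks.
(** * The lower bound: a Moran set in the level set *)

Section Moran.
Context (R : realType) (d N : nat).
Context (S : 'I_N -> 'rV[R]_d -> 'rV[R]_d) (r p : 'I_N -> R).
Context (K : set 'rV[R]_d) (mu : probability (borel_rV R d) R).
Hypothesis H : osc_system S r p K mu.
Implicit Types (v w x : seq 'I_N) (y z : 'rV[R]_d) (om : nat -> seq 'I_N).

Let r01 := ratio01 H.
Let p01 := weight01 H.
Let r_gt0 := ratio_gt0 H.
Let p_gt0 := weight_gt0 H.
Let rho_gt0 := wratio_gt0 H.
Let pw_gt0 := wweight_gt0 H.

Lemma wratio_prefix v w : prefix v w -> wprod r w <= wprod r v.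
Proof.
case/prefixP=> x ->; rewrite wprod_cat ler_piMr ?(wratio_le1 H) //.
exact: ltW.
Qed.

Lemma ln_wratio_linear_ge : exists2 k : R, 0 < k &
  forall w, - ln (wprod r w) <= k * (size w)%:R.
Proof.
have [c [c0 c1 cr]] := fin_inf_gt0 r_gt0; exists (- ln c).
  by rewrite oppr_gt0 ln_lt0 // c0.
move=> w; rewrite mulNr lerN2 mulr_natr -lnXn // ler_ln ?posrE ?exprn_gt0 //.
exact: wprod_ge_exp.
Qed.

Definition spell om k : seq 'I_N := flatten (mkseq om k).

Lemma spellS om k : spell om k.+1 = spell om k ++ om k.
Proof. by rewrite /spell mkseqS flatten_rcons. Qed.

Lemma spell_prefix om k m : (k <= m)%N -> prefix (spell om k) (spell om m).
Proof.
move=> /subnK <-; elim: (m - k)%N => [|n IH]; first exact: prefix_refl.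
by rewrite addSn spellS; apply: prefix_trans IH (prefix_prefix _ _).
Qed.

Definition coded om y := forall k, cyl S K (spell om k) y.

(** Cylinders are closed and nested along a path, inside a compact set. *)
Lemma coded_exists om : exists y, coded om y.
Proof.
have [k0 Kk0] := attractor_nonempty H.
pose z n := wmap S (spell om n) k0.
have Kz : \forall n \near \oo, K (z n).
  by apply: nearW => n; exact: (wmap_attractor H).
have [y [_ cy]] := @attractor_compact _ _ _ _ _ _ _ _ H (z n @[n --> \oo]) _ Kz.
exists y => k; apply: (cyl_closed H) => B By.
suff zk : \forall n \near \oo, cyl S K (spell om k) (z n) by exact: (cy _ _ zk By).
near=> n; have kn : prefix (spell om k) (spell om n).
  by apply: spell_prefix; near: n; exact: nbhs_infty_ge.
by apply: (cyl_prefix H kn); exists k0.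
Unshelve. all: by end_near. Qed.

Section Scheme.
Context (al s1 : R) (u : seq 'I_N).
Context (L : nat -> nat) (A : nat -> seq (seq 'I_N)) (W : nat -> seq 'I_N -> R).
Hypothesis al0 : 0 < al.
Hypothesis buf : buffer S r K u.
Hypotheses (A_uniq : forall j, uniq (A j)) (W_ge0 : forall j g, 0 <= W j g).
Hypothesis W_sum : forall j, \sum_(g <- A j) W j g = 1.
Hypothesis A_shape : forall j w, w \in A j -> size w = L j /\ exists g, w = g ++ u.
Hypothesis L_gt0 : forall j, (0 < L j)%N.
Hypothesis L_slow : forall eta : R, 0 < eta ->
  exists k0, forall k, (k0 <= k)%N -> (L k)%:R <= eta * k%:R.
Hypothesis A_exponent : forall eta : R, 0 < eta -> exists J, forall j, (J <= j)%N ->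
  forall w, w \in A j -> 0 < W j w ->
    `|ln (wprod p w) - al * ln (wprod r w)| <= eta * - ln (wprod r w).
Hypothesis A_weight : forall j w, w \in A j -> 0 < W j w ->
  ln (W j w) <= s1 * ln (wprod r w).

Definition admissible om := forall j, om j \in A j /\ 0 < W j (om j).

Definition depth om k : R := - ln (wprod r (spell om k)).

Lemma depthS om k : depth om k.+1 = depth om k - ln (wprod r (om k)).
Proof. by rewrite /depth spellS wprod_cat lnM ?posrE // opprD. Qed.

Lemma admissible_exists : exists om, admissible om.
Proof.
suff /choice[om h] : forall j, exists g, g \in A j /\ 0 < W j g by exists om.
move=> j; apply: contrapT => ng.
have : \sum_(g <- A j) W j g = 0.
  rewrite big_seq big1 // => g gA; apply/eqP; rewrite eq_le W_ge0 andbT leNgt.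
  by apply/negP => Wg; apply: ng; exists g.
by rewrite W_sum => /eqP; rewrite oner_eq0.
Qed.

Lemma shape_admissible om k : admissible om ->
  shape (mkseq om k) = mkseq L k.
Proof.
move=> hom; rewrite /shape /mkseq -map_comp; apply: eq_map => j /=.
by have [/A_shape[]] := hom j.
Qed.

Lemma size_spell om k : admissible om -> size (spell om k) = sumn (mkseq L k).
Proof. by move=> hom; rewrite size_flatten shape_admissible. Qed.

Lemma size_spell_ge om k : admissible om -> (k <= size (spell om k))%N.
Proof.
move=> hom; elim: k => // k IH; rewrite spellS size_cat -addn1 leq_add //.
by have [/A_shape[-> _] _] := hom k.
Qed.

Lemma spell_suffix om k : admissible om ->
  exists x, spell om k.+1 = x ++ u.
Proof.
move=> hom; have [/A_shape[_ [g e]] _] := hom k.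
by exists (spell om k ++ g); rewrite spellS e catA.
Qed.

(** The buffers separate the pieces of the Moran set. *)
Lemma coded_separated om om' y y' k : admissible om -> admissible om' ->
  coded om y -> coded om' y' -> (0 < k)%N ->
  enorm (y - y') <= wprod r (spell om k) -> mkseq om k = mkseq om' k.
Proof.
case: k => // k hom hom' cy cy' _ yy'.
have [x xE] := spell_suffix k hom; have [x' xE'] := spell_suffix k hom'.
have [n hn] := wprod_small r01 (rho_gt0 (spell om k.+1)).
pose m := maxn n k.+1.
have rm : wprod r (spell om' m) <= wprod r (spell om k.+1).
  apply: ltW; apply: hn; apply: leq_trans (size_spell_ge m hom').
  exact: leq_maxl.
have [v vm sv] := stop_prefix r01 (rho_gt0 (spell om k.+1)) rm.
have vy' : cyl S K v y' by apply: (cyl_prefix H vm).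
have xv : prefix x v.
  by apply: (buf (y := y) (z := y')) => //; rewrite -xE.
have xx' : size x = size x'.
  have := size_spell k.+1 hom; rewrite -(size_spell k.+1 hom') xE xE'.
  by rewrite !size_cat => /addIn.
have e : x = x'.
  have h1 : prefix x (spell om' m) by apply: prefix_trans xv vm.
  have h2 : prefix x' (spell om' m).
    apply: prefix_trans (spell_prefix om' (leq_maxr n k.+1)).
    by rewrite xE' prefix_prefix.
  by move: h1 h2; rewrite !prefixE xx' => /eqP <- /eqP.
apply: eq_from_flatten_shape; last by rewrite !shape_admissible.
by rewrite -/(spell om k.+1) -/(spell om' k.+1) xE xE' e.
Qed.

Lemma depth_ge : exists2 k0 : R, 0 < k0 &
  forall om k, admissible om -> k0 * k%:R <= depth om k.
Proof.
have [c c0 hc] := ln_wratio_linear r01; exists c => // om k hom.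
apply: le_trans (hc _); rewrite ler_pM2l // ler_nat.
exact: size_spell_ge.
Qed.

Lemma depth_slow (eta : R) : 0 < eta -> exists k0, forall om k, admissible om ->
  (k0 <= k)%N -> depth om k.+1 <= (1 + eta) * depth om k.
Proof.
move=> eta0; have [c c0 hc] := depth_ge; have [c' c'0 hc'] := ln_wratio_linear_ge.
have ec : 0 < eta * c / c' by rewrite divr_gt0 // mulr_gt0.
have [k0 hk0] := L_slow ec; exists k0 => om k hom kk0.
rewrite depthS mulrDl mul1r lerD2l; apply: le_trans (hc' _) _.
have [/A_shape[-> _] _] := hom k.
apply: le_trans (_ : c' * (eta * c / c' * k%:R) <= _).
  by rewrite ler_pM2l // hk0.
have -> : c' * (eta * c / c' * k%:R) = eta * (c * k%:R).
  by field; rewrite gt_eqF.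
by rewrite ler_pM2l // hc.
Qed.

(** Any small scale lies between two consecutive generations; how small it
    has to be for these to be late does not depend on the path. *)
Lemma scale_exists k0 : exists2 delta : R, 0 < delta &
  forall om rho, admissible om -> 0 < rho -> rho < delta ->
    exists k, [/\ (k0 <= k)%N, rho < wprod r (spell om k) &
      wprod r (spell om k.+1) <= rho].
Proof.
have [c [c0 c1 cr]] := fin_inf_gt0 r_gt0.
exists (c ^+ sumn (mkseq L k0)); first by rewrite exprn_gt0.
move=> om rho hom rho_0 rhod.
have rho_k : rho < wprod r (spell om k0).
  apply: lt_le_trans rhod _; rewrite -(size_spell k0 hom).
  exact: wprod_ge_exp.
have [n hn] := wprod_small r01 rho_0.
have ex : exists n, wprod r (spell om n) <= rho.
  by exists n; apply: ltW; apply: hn; exact: size_spell_ge.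
case: (ex_minnP ex) => m hm mmin.
have mk : (k0 < m)%N.
  rewrite ltnNge; apply/negP => /(spell_prefix om)/wratio_prefix h.
  by have := lt_le_trans rho_k (le_trans h hm); rewrite ltxx.
case: m mk hm mmin => // k kk hm mmin; exists k; split => //.
by rewrite ltNge; apply/negP => /mmin; rewrite ltnn.
Qed.

Lemma spell_exponent om (eta : R) : admissible om -> 0 < eta ->
  exists J C, 0 <= C /\ forall k, (J <= k)%N ->
    `|ln (wprod p (spell om k)) + al * depth om k| <= C + eta * depth om k.
Proof.
move=> hom eta0; have [J hJ] := A_exponent eta0.
pose f k := ln (wprod p (spell om k)) + al * depth om k.
exists J, `|f J|; split=> // k /subnK <-.
have h n : `|f (n + J)%N| <= `|f J| + eta * (depth om (n + J) - depth om J).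
  elim: n => [|n IH]; first by rewrite add0n subrr mulr0 addr0.
  rewrite addSn depthS.
  have -> : f (n + J).+1 = f (n + J)%N + (ln (wprod p (om (n + J)%N))
      - al * ln (wprod r (om (n + J)%N))).
    by rewrite /f depthS spellS wprod_cat lnM ?posrE //; ring.
  have [oA oW] := hom (n + J)%N.
  have h := hJ (n + J)%N (leq_addl _ _) _ oA oW.
  apply: le_trans (ler_normD _ _) _; apply: le_trans (lerD IH h) _.
  by rewrite le_eqVlt; apply/orP; left; apply/eqP; ring.
apply: le_trans (h _) _; rewrite lerD2l ler_pM2l // gerBl.
by rewrite oppr_ge0 ln_le0 // (wratio_le1 H).
Qed.

(** Between two generations the mass of a ball is comparable to the weight of
    the current word: the buffer keeps foreign cylinders away from it. *)
Lemma coded_exponent om y (e : R) : admissible om -> coded om y -> 0 < e ->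
  exists2 delta, 0 < delta & forall rho, 0 < rho -> rho < delta ->
    `|ball_exponent mu y rho - al| <= e.
Proof.
move=> hom cy e0; have [c c0 hc] := mass_ball_lower H.
have [M M1 hM] := mass_ball_upper H; have M0 : 0 < M by lra.
pose eta := Num.min 1 (e / 2 / (al + 2)).
have al0' := al0; have al2 : 0 < al + 2 by lra.
have eta0 : 0 < eta by rewrite lt_min ltr01 !divr_gt0.
have eta1 : eta <= 1 by rewrite ge_min lexx.
have etae : eta * (al + 2) <= e / 2.
  by rewrite -ler_pdivlMr // ge_min lexx orbT.
have [J [C [C0 hJ]]] := spell_exponent hom eta0.
have [k1 hk1] := depth_slow eta0.
have [del del0 hdel] := scale_exists (maxn (maxn J k1) 1).
pose C1 := C + `|ln c| + `|ln M - ln (wprod p u)|.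
have C10 : 0 <= C1 by rewrite !addr_ge0.
exists (Num.min (Num.min 2^-1 del) (expR (- (2 * C1 / e)))).
  by rewrite !lt_min del0 expR_gt0 invr_gt0 ltr0n.
move=> rho rho_0; rewrite !lt_min => /andP[/andP[rho2 rhod] rhoC].
have lr0 : ln rho < 0 by rewrite ln_lt0 // rho_0 /=; lra.
have TC : C1 <= e / 2 * - ln rho.
  have : ln rho < - (2 * C1 / e) by rewrite -ltr_expR lnK.
  by rewrite ltrNr ltr_pdivrMr //; lra.
have [k [+ rk rk1]] := hdel om rho hom rho_0 rhod.
rewrite !geq_max => /andP[/andP[Jk k1k] k0].
have m0 := ball_mass_gt0 H (cyl_attractor H (cy 0%N)) rho_0.
have low := hc _ _ _ (cy k.+1) rk1.
have upp : mass mu (closed_eball y rho) <= M * (wprod p (spell om k) / wprod p u).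
  case: k k0 {Jk k1k rk1 low} rk => // k _ rk; have [x xE] := spell_suffix k hom.
  apply: le_trans (_ : mass mu (closed_eball y (wprod r (spell om k.+1))) <= _).
    apply: le_mass; try exact: closed_closed_eball.
    by move=> z /le_trans; apply; exact: ltW.
  apply: hM => //; first exact: (wratio_le1 H).
    by rewrite divr_ge0 // ltW.
  move=> v z sv vz zy; rewrite xE wprod_cat mulfK ?gt_eqF //.
  have /prefixP[w ->] : prefix x v.
    by apply: (buf (y := y) (z := z)) => //; rewrite -xE // enormC.
  by rewrite wprod_cat ler_piMr ?(wweight_le1 H) // ltW.
rewrite -ler_ln ?posrE ?mulr_gt0 // lnM ?posrE // in low.
have {}upp : ln (mass mu (closed_eball y rho)) <=
    ln M + (ln (wprod p (spell om k)) - ln (wprod p u)).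
  have wk := pw_gt0 (spell om k); have wu := pw_gt0 u.
  rewrite -lnV ?posrE // -lnM ?posrE ?invr_gt0 //.
  rewrite -lnM ?posrE ?mulr_gt0 ?invr_gt0 //.
  by rewrite ler_ln ?posrE ?mulr_gt0 ?invr_gt0.
rewrite /ball_exponent -/(mass mu _).
have -> : ln (mass mu (closed_eball y rho)) / ln rho - al =
    (ln (mass mu (closed_eball y rho)) - al * ln rho) / ln rho.
  by field; rewrite lt_eqF.
rewrite normrM normfV ler_pdivrMr ?normr_gt0 ?lt_eqF // (ltr0_norm lr0).
have d0 : depth om k <= - ln rho by rewrite lerN2 ler_ln ?posrE // ltW.
have d1 : - ln rho <= depth om k.+1 by rewrite lerN2 ler_ln ?posrE.
have d2 := hk1 om k hom k1k.
have hk := hJ k Jk; have hkS := hJ k.+1 (leqW Jk).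
have cc := ler_norm (- ln c); rewrite normrN in cc.
have cM := ler_norm (ln M - ln (wprod p u)).
have c1 := normr_ge0 (ln c); have c2 := normr_ge0 (ln M - ln (wprod p u)).
move: hk hkS; rewrite !ler_norml => /andP[hk1' hk2'] /andP[hk3 hk4].
set T := - ln rho in TC d0 d1 *; have T0 : 0 < T by rewrite oppr_gt0.
have -> : ln rho = - T by rewrite opprK.
have eT : eta * (al + 2) * T <= e / 2 * T by rewrite ler_wpM2r // ltW.
have dk0 : 0 <= depth om k by rewrite oppr_ge0 ln_le0 // (wratio_le1 H).
have d3 : depth om k.+1 <= (1 + eta) * T.
  by apply: le_trans d2 _; rewrite ler_wpM2l //; lra.
have d4 : (al + eta) * depth om k.+1 <= (al + eta) * ((1 + eta) * T).
  by rewrite ler_wpM2l //; lra.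
have d5 : eta * eta * T <= eta * T.
  by rewrite -mulrA ler_piMl // mulr_ge0 // ltW.
have d6 : al * T <= al * ((1 + eta) * depth om k).
  by rewrite ler_pM2l //; exact: le_trans d1 d2.
have d7 : eta * (al + 1) * depth om k <= eta * (al + 1) * T.
  by rewrite ler_wpM2l // mulr_ge0 //; lra.
have eT0 : 0 < eta * T by rewrite mulr_gt0.
by rewrite /C1 in TC; apply/andP; split; lra.
Qed.

Lemma coded_level_set om y (I : set R) : admissible om -> coded om y -> I al ->
  level_set K mu I y.
Proof.
move=> hom cy Ial; split; first exact: (cyl_attractor H (cy 0%N)).
move=> a [a0 [q_ [q0 _ qcv Dcv]]].
suff -> : a = al by [].
apply: cvg_unique Dcv _ => //; apply/cvgrPdist_le => e e0.
have [del del0 hdel] := coded_exponent hom cy e0.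
move/cvgrPdist_lt: qcv => /(_ _ del0) qcv.
near=> n; rewrite distrC; apply: hdel => //.
have : `|0 - q_ n| < del by near: n.
by rewrite sub0r normrN gtr0_norm.
Unshelve. all: by end_near. Qed.

Lemma path_weight_rcons j (zs : seq (seq 'I_N)) g :
  path_weight W j (rcons zs g) = path_weight W j zs * W (j + size zs) g.
Proof.
elim: zs j => [|h zs IH] j /=; first by rewrite addn0 mulr1 mul1r.
by rewrite IH mulrA addnS.
Qed.

Lemma ln_path_weight om k : admissible om ->
  0 < path_weight W 0 (mkseq om k) /\
  ln (path_weight W 0 (mkseq om k)) <= - (s1 * depth om k).
Proof.
move=> hom; elim: k => [|k [IH0 IH]].
  by rewrite /= ln1 /depth /spell /= wprod_nil ln1 oppr0 mulr0 oppr0.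
have [oA oW] := hom k; have hw := A_weight oA oW.
rewrite mkseqS path_weight_rcons add0n size_mkseq mulr_gt0 //; split=> //.
by rewrite lnM ?posrE // depthS; lra.
Qed.

(** A small set meets the pieces of the Moran set along a single path, down
    to the generation of its size; lengthening the words slowly makes two
    consecutive generations comparable up to an exponent close to 1. *)
Lemma small_set_path (t t' : R) : 0 <= t -> t < t' -> t' < s1 ->
  exists2 delta, 0 < delta & forall (V : set 'rV[R]_d) (eta : R), 0 < eta ->
    (diam V <= delta%:E)%E ->
    exists zs : seq (seq 'I_N),
      ((path_weight W 0 zs)%:E <= diam_pow t V + eta%:E)%E /\
      forall om y, admissible om -> coded om y -> V y -> mkseq om (size zs) = zs.
Proof.
move=> t0 tt' ts; have t'0 : 0 < t' by lra.
have b0 : 0 < s1 / t' - 1 by rewrite subr_gt0 ltr_pdivlMr // mul1r.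
have [k1 hk1] := depth_slow b0.
have [del del0 hdel] := scale_exists (maxn k1 1).
pose delta := Num.min 1 (del / 2).
have delta0 : 0 < delta by rewrite lt_min ltr01 divr_gt0.
have delta1 : delta <= 1 by rewrite ge_min lexx.
have deltad : delta < del.
  by apply: le_lt_trans (_ : _ <= del / 2) _; rewrite ?ge_min ?lexx ?orbT //; lra.
exists delta => // V eta eta0 Vd.
have [D [D0 Dd Dt VD]] := diam_real t0 tt' delta0 delta1 Vd.
have [eta' eta'0 heta'] := powR_small t'0 ltr01 eta0.
pose rho := Num.max D (Num.min eta' delta).
have rho_0 : 0 < rho by rewrite lt_max lt_min eta'0 delta0 orbT.
have rhod : rho < del.
  by rewrite gt_max (le_lt_trans Dd deltad) gt_min deltad orbT.
have rhot : ((rho `^ t')%:E <= diam_pow t V + eta%:E)%E.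
  have m0 : 0 < Num.min eta' delta by rewrite lt_min eta'0.
  apply: le_trans (_ : (D `^ t' + eta)%:E <= _)%E; last first.
    by rewrite EFinD leeD2r.
  rewrite lee_fin /rho; have [_|_] := leP D (Num.min eta' delta).
    apply: le_trans (_ : eta <= _); last by rewrite lerDr powR_ge0.
    by rewrite -[leLHS]mul1r; apply: heta'; [exact: ltW|rewrite ge_min lexx].
  by rewrite lerDl ltW.
have [om [hom omV]] : exists om, admissible om /\
    ((exists om' y, [/\ admissible om', coded om' y & V y]) ->
     exists2 y, coded om y & V y).
  have [[om' [y [hom' cy Vy]]]|nex] :=
      pselect (exists om' y, [/\ admissible om', coded om' y & V y]).
    by exists om'; split => // _; exists y.
  by have [om hom] := admissible_exists; exists om.
have [k [+ rk rk1]] := hdel om rho hom rho_0 rhod.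
rewrite geq_max => /andP[k1k k0].
exists (mkseq om k); rewrite size_mkseq; split; last first.
  move=> om' y hom' cy' Vy; have [|y0 cy0 Vy0] := omV; first by exists om', y.
  apply/esym/(coded_separated hom hom' cy0 cy' k0).
  apply: le_trans (VD _ _ Vy0 Vy) _; apply: le_trans (ltW rk).
  by rewrite le_max lexx.
apply: le_trans rhot; rewrite lee_fin.
have [w0 hw] := ln_path_weight k hom.
rewrite -ler_ln ?posrE ?powR_gt0 // ln_powR; apply: le_trans hw _.
have d1 : - ln rho <= depth om k.+1 by rewrite lerN2 ler_ln ?posrE.
have d2 := hk1 om k hom k1k.
have : - (t' * ln rho) <= s1 * depth om k.
  rewrite -mulrN -ler_pdivlMl //; apply: le_trans d1 _; apply: le_trans d2 _.
  by rewrite le_eqVlt; apply/orP; left; apply/eqP; field; rewrite gt_eqF.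
lra.
Qed.

Lemma moran_lower (I : set R) (t : R) : 0 <= t -> t < s1 -> I al ->
  hausdorff_measure t (level_set K mu I) <> 0%E.
Proof.
move=> t0 ts Ial H0.
have tt' : t < (t + s1) / 2 by lra.
have t's : (t + s1) / 2 < s1 by lra.
have [delta delta0 hdelta] := small_set_path t0 tt' t's.
have q4 : 0 < 4^-1 :> R by rewrite invr_gt0.
have [_ [U [EU Ud] <-] Usum] : exists2 c, [set (\sum_(0 <= n <oo) diam_pow t (U n))%E
    | U in [set U : nat -> set 'rV[R]_d | level_set K mu I `<=` \bigcup_n U n /\
      forall n, (diam (U n) <= delta%:E)%E]] c & (c < (4^-1 : R)%:E)%E.
  apply: contrapT => nex.
  have : ((4^-1 : R)%:E <= hausdorff_measure t (level_set K mu I))%E.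
    apply: le_trans (_ : hausdorff_content t delta (level_set K mu I) <= _)%E.
      apply: le_ereal_inf_tmp => c hc; rewrite leNgt; apply/negP => lt.
      by apply: nex; exists c.
    by apply: ereal_sup_ubound; exists delta.
  by rewrite H0 lee_fin leNgt q4.
have en n : 0 < 4^-1 / (2 ^ n.+1)%:R :> R by rewrite divr_gt0 // ltr0n expn_gt0.
have /choice[z hz] n := hdelta (U n) _ (en n) (Ud n).
have [|om [hom omz]] := path_avoiding A_uniq W_ge0 W_sum (z := z).
  apply: (@le_lt_trans _ _ (\sum_(0 <= n <oo)
      (diam_pow t (U n) + (4^-1 / (2 ^ n.+1)%:R)%:E))%E).
    apply: lee_nneseries => [n _ _|n _]; last by have [] := hz n.
    by rewrite lee_fin path_weight_ge0.
  apply: le_lt_trans (epsilon_trick xpredT _ (ltW q4)) _.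
    by move=> n; exact: diam_pow_ge0.
  apply: (@lt_trans _ _ ((4^-1 : R)%:E + (4^-1 : R)%:E)%E).
    by rewrite lteD2rE.
  by rewrite -EFinD lte_fin; lra.
have [y cy] := coded_exists om.
have [n _ Uy] := EU y (coded_level_set hom cy Ial).
by apply: (omz n); have [_] := hz n; apply.
Qed.

End Scheme.
End Moran.
(** * The dimension formula *)

Section Dimension.
Context (R : realType) (d N : nat).
Context (S : 'I_N -> 'rV[R]_d -> 'rV[R]_d) (r p : 'I_N -> R).
Context (K : set 'rV[R]_d) (mu : probability (borel_rV R d) R).
Context (beta : R -> R) (i0 i1 : 'I_N).
Hypothesis H : osc_system S r p K mu.
Hypothesis betaE : forall q : R, \sum_(i < N) (p i `^ q * r i `^ beta q) = 1.
Hypothesis ext : forall i, exponent r p i0 <= exponent r p i <= exponent r p i1.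

(** Blocks of accuracy [e] are used from the moment at which their length is
    at most a fraction [1 / e] of the number of blocks already written: the
    accuracy still tends to infinity, and blocks stay short compared with
    the words that they extend. *)
Lemma hausdorff_measure_neq0 (I : set R) al s t :
  exponent r p i0 <= al -> al <= exponent r p i1 ->
  (forall q, s <= al * q + beta q) -> 0 <= t -> t < s -> I al ->
  hausdorff_measure t (level_set K mu I) <> 0%E.
Proof.
move=> al0 al1 hs t0 ts Ial.
have r01 := ratio01 H; have p01 := weight01 H.
have [u buf] := buffer_exists H.
pose eps e : R := Num.min ((s - t) / 2) e.+1%:R^-1.
have eps0 e : 0 < eps e by rewrite lt_min invr_gt0 ltr0n andbT; lra.
have /choice[B hB] e : exists B : nat * seq (seq 'I_N) * (seq 'I_N -> R),
    [/\ [/\ (0 < B.1.1)%N, uniq B.1.2 & forall w, 0 <= B.2 w],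
        \sum_(w <- B.1.2) B.2 w = 1,
        forall w, w \in B.1.2 -> size w = B.1.1 /\ exists g, w = g ++ u &
        forall w, w \in B.1.2 -> 0 < B.2 w ->
          `|ln (wprod p w) - al * ln (wprod r w)| <= eps e * - ln (wprod r w) /\
          ln (B.2 w) <= (s - eps e) * ln (wprod r w)].
  have [L [A [W hLAW]]] := block_exists r01 p01 betaE ext u al0 al1 hs (eps0 e).
  by exists (L, A, W).
have /choice[a ha] j : exists e : nat, (e * (B e).1.1 <= j)%N /\
    forall e', (e' <= j)%N -> (e' * (B e').1.1 <= j)%N -> (e' <= e)%N.
  have ex : exists e, (e <= j)%N && (e * (B e).1.1 <= j)%N.
    by exists 0%N; rewrite mul0n.
  have ub e : (e <= j)%N && (e * (B e).1.1 <= j)%N -> (e <= j)%N.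
    by case/andP.
  case: (ex_maxnP ex ub) => e /andP[ej ej'] emax; exists e; split => // e' h h'.
  by apply: emax; rewrite h.
have a_large E : exists J, forall j, (J <= j)%N -> (E <= a j)%N.
  exists (maxn E (E * (B E).1.1)) => j; rewrite geq_max => /andP[h h'].
  by have [_] := ha j; apply.
have lnr w : ln (wprod r w) <= 0 by rewrite ln_le0 // (wratio_le1 H).
have nat_gt (x : R) : 0 < x -> exists n : nat, n.+1%:R^-1 <= x.
  move=> x0; have [n _ hn] : \forall n \near \oo, n.+1%:R^-1 < x :> R.
    exact: near_infty_natSinv_lt (PosNum x0).
  by exists n; rewrite ltW // (hn n (leqnn n)).
apply: (moran_lower H (al := al) (s1 := s - (s - t) / 2) (u := u)
  (L := fun j => (B (a j)).1.1) (A := fun j => (B (a j)).1.2)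
  (W := fun j => (B (a j)).2)) => //.
- by apply: lt_le_trans al0; exact: exponent_gt0 r01 p01 i0.
- by move=> j; have [[]] := hB (a j).
- by move=> j; have [[]] := hB (a j).
- by move=> j; have [_] := hB (a j).
- by move=> j; have [_ _] := hB (a j).
- by move=> j; have [[]] := hB (a j).
- move=> eta eta0; have [n hn] := nat_gt eta eta0.
  have [J hJ] := a_large n.+1; exists J => j /hJ naj.
  have [h _] := ha j; rewrite -ler_pdivrMl //.
  apply: le_trans (_ : n.+1%:R * (B (a j)).1.1%:R <= _).
    by rewrite ler_wpM2r // -[leRHS]invrK lef_pV2 ?posrE ?invr_gt0.
  by rewrite -natrM ler_nat (leq_trans _ h) // leq_mul2r naj orbT.
- move=> eta eta0; have [n hn] := nat_gt eta eta0.
  have [J hJ] := a_large n; exists J => j /hJ naj w wA wW.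
  have [_ _ _ /(_ w wA wW)[h _]] := hB (a j).
  apply: le_trans h _; rewrite ler_wpM2r ?oppr_ge0 //.
  apply: le_trans hn; apply: le_trans (_ : (a j).+1%:R^-1 <= _).
    by rewrite ge_min lexx orbT.
  by rewrite lef_pV2 ?posrE // ler_nat.
- move=> j w wA wW; have [_ _ _ /(_ w wA wW)[_ h]] := hB (a j).
  apply: le_trans h _; rewrite ler_wnM2r // lerD2l lerN2.
  by rewrite ge_min lexx.
- lra.
Qed.

Lemma hausdorff_dim_level_set (I : set R) a b :
  a <= b -> exponent r p i0 <= a -> b <= exponent r p i1 ->
  (forall al, I al <-> a <= al <= b) ->
  hausdorff_dim (level_set K mu I) = ereal_sup [set legendre beta al | al in I].
Proof.
move=> ab al0 bl1 Iab; have r01 := ratio01 H; have p01 := weight01 H.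
have i00 : 0 < exponent r p i0 by exact: exponent_gt0.
apply/eqP; rewrite eq_le; apply/andP; split; last first.
  apply: ge_ereal_sup => _ [al /[dup] Ial /Iab/andP[aal alb] <-].
  apply: le_ereal_inf_tmp => _ [t [/= t0 Ht] <-].
  rewrite leNgt; apply/negP => tl.
  have lq q : (legendre beta al <= (al * q + beta q)%:E)%E.
    by apply: ereal_inf_lbound; exists q.
  have lfin : legendre beta al \is a fin_num.
    by rewrite fin_numElt (lt_trans (ltNyr t) tl) (le_lt_trans (lq 0) (ltry _)).
  rewrite -(fineK lfin) lte_fin in tl.
  apply: (hausdorff_measure_neq0 (I := I) (al := al) _ _ _ t0 tl) Ht => //.
  - exact: le_trans aal.
  - exact: le_trans bl1.
  - by move=> q; rewrite -lee_fin fineK.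
pose F q := Num.max (a * q) (b * q) + beta q.
have F0 q : 0 <= F q.
  apply: le_trans (_ : a * q + beta q <= _); last by rewrite lerD2r le_max lexx.
  by apply: (tangent_ge0 r01 p01 betaE (i0 := i0) (i1 := i1)) => //; exact: le_trans bl1.
pose m := inf (range F).
have mF q : m <= F q by apply: ge_inf; [exists 0 => _ [q' _ <-]|exists q].
have m0 : 0 <= m by apply: lb_le_inf; [exists (F 0), 0|move=> _ [q _ <-]].
have [al [aal alb hal]] := legendre_minimax r01 p01 betaE ab mF.
have Ial : I al by apply/Iab; rewrite aal.
apply: (@le_trans _ _ m%:E); last first.
  apply: le_trans (_ : legendre beta al <= _)%E; last first.
    by apply: ereal_sup_ubound; exists al.
  by apply: le_ereal_inf_tmp => _ [q _ <-]; rewrite lee_fin.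
apply/lee_addgt0Pr => e e0.
have [_ [q _ <-] qe] : exists2 x, range F x & x < m + e.
  by apply: inf_adherent => //; split; [exists (F 0), 0|exists 0 => _ [q _ <-]].
have me : 0 < m + e by rewrite ltr_wpDl.
apply: ereal_inf_lbound; exists (m + e) => //; split; first exact: ltW.
apply: (hausdorff_measure_level_set H betaE ext (a := a) (b := b) (q := q)) => //.
- by move=> x /Iab.
- by lra.
Qed.

End Dimension.

Lemma alpha_min_attained (R : realType) (N : nat) (p r : 'I_N -> R) (i : 'I_N) :
  exists i0, alpha_min p r = (exponent r p i0)%:E /\
    forall j, exponent r p i0 <= exponent r p j.
Proof.
have [|j _ jE] := @eq_bigmin _ _ _ +oo%E i xpredT
    (fun i => (ln (p i) / ln (r i))%:E) isT.
  by move=> j _; rewrite leey.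
exists j; split=> // k; rewrite -lee_fin /exponent -jE.
exact: (bigmin_le _ _ (fun i => (ln (p i) / ln (r i))%:E)).
Qed.

Lemma alpha_max_attained (R : realType) (N : nat) (p r : 'I_N -> R) (i : 'I_N) :
  exists i1, alpha_max p r = (exponent r p i1)%:E /\
    forall j, exponent r p j <= exponent r p i1.
Proof.
have [|j _ jE] := @eq_bigmax _ _ _ -oo%E i xpredT
    (fun i => (ln (p i) / ln (r i))%:E) isT.
  by move=> j _; rewrite leNye.
exists j; split=> // k; rewrite -lee_fin /exponent -jE.
exact: (le_bigmax _ (fun i => (ln (p i) / ln (r i))%:E)).
Qed.

Lemma closed_inf (R : realType) (A : set R) : closed A -> A !=set0 ->
  has_lbound A -> A (inf A).
Proof.
move=> cA A0 Ab; apply: cA => B /nbhs_ballP[e /= e0 eB].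
have [x Ax xe] := inf_adherent e0 (conj A0 Ab).
exists x; split=> //; apply: eB; rewrite /ball /= distrC ger0_norm.
  by rewrite ltrBlDl.
by rewrite subr_ge0; exact: ge_inf.
Qed.

Theorem corollary1p1 (R : realType) (d N : nat)
  (S : 'I_N -> 'rV[R]_d -> 'rV[R]_d) (r p : 'I_N -> R)
  (K : set 'rV[R]_d) (mu : probability (borel_rV R d) R)
  (beta : R -> R) (I : set R)
  (hN : (2 <= N)%N)
  (hr : forall i, 0 < r i < 1)
  (hS : forall i, similarity (r i) (S i))
  (hp : forall i, 0 < p i)
  (hp1 : \sum_(i < N) p i = 1)
  (hK : self_similar_set S K)
  (hmu : self_similar_measure S p mu)
  (hOSC : open_set_condition S)
  (hbeta : forall q : R, \sum_(i < N) (p i `^ q * r i `^ beta q) = 1)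
  (hI0 : I !=set0) (hIint : is_interval I) (hIcl : closed I)
  (hIsub : forall a : R, I a -> (alpha_min p r <= a%:E <= alpha_max p r)%E) :
  hausdorff_dim [set x | K x /\ acc_points (ball_exponent mu x) `<=` I] =
  ereal_sup [set legendre beta alpha | alpha in I].
Proof.
have H : osc_system S r p K mu by split.
have [i0 [i0E i0min]] := alpha_min_attained p r (Ordinal hN).
have [i1 [i1E i1max]] := alpha_max_attained p r (Ordinal hN).
have ext i : exponent r p i0 <= exponent r p i <= exponent r p i1.
  by rewrite i0min i1max.
have Iext a : I a -> exponent r p i0 <= a <= exponent r p i1.
  by move=> /hIsub; rewrite i0E i1E !lee_fin.
have lbI : has_lbound I by exists (exponent r p i0) => a /Iext/andP[].
have ubI : has_ubound I by exists (exponent r p i1) => a /Iext/andP[].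
have Ia := closed_inf hIcl hI0 lbI.
have Ib : I (sup I) by apply: hIcl; exact: closure_sup.
have /andP[a0 _] := Iext _ Ia; have /andP[_ b1] := Iext _ Ib.
apply: (hausdorff_dim_level_set H hbeta ext (a := inf I) (b := sup I)) => //.
  exact: ge_inf.
move=> al; split=> [Ial|/andP[aal alb]]; first by rewrite ge_inf // ub_le_sup.
by apply: (hIint _ _ Ia Ib); rewrite aal.
Qed.
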